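(* Let $u\in V$ be a steady Navier-Stokes solution with $K_1:=\|\nabla u\|_{L^\infty(\Omega)}<\infty$ and let $I_H(u)$ be its coarse mesh interpolant. Let $\epsilon\in V$ be the noise function, $u_0\in V$, and let $(u_k)_{k\ge0}\subset V$ be the CDA-Picard iterates with noisy data, defined by $$\nu(\nabla u_{k+1},\nabla v)+b(u_k,u_{k+1},v)+\mu\big(I_Hu_{k+1}-I_H(u+\epsilon),\,I_Hv\big)=(f,v)\qquad\forall v\in V .$$ Denote $e_k:=u_k-u$ and $$\bar\lambda:=\min\left\{\frac{\nu}{C_I^2H^2},\frac{\mu}{2}\right\}.$$ Pick parameters $\mu$ and $H$ such that $\bar\lambda>2$, $H\le\dfrac{\nu^{1/2}}{\sqrt2\,K_1C_I}$ and $\mu\ge4K_1^2$. Then $$\|e_k\|^2\le\left(\frac{2}{\bar\lambda}\right)^k\|e_0\|^2+\frac{2\mu}{\bar\lambda-2}\|I_H\epsilon\|^2 .$$ Moreover, if $\mu\le\frac{\nu}{C_I^2H^2}$ (equivalently $H\le\frac{\nu^{1/2}}{\mu^{1/2}C_I}$), then $$\|e_k\|^2\le\left(\frac{2}{\bar\lambda}\right)^k\|e_0\|^2+\frac{4\mu}{\mu-4}\|I_H\epsilon\|^2 .$$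
   Context: $\Omega\subset\mathbb{R}^d$, $d\in\{2,3\}$, is an open connected set that is a convex polygon or has smooth boundary. $(\cdot,\cdot)$ and $\|\cdot\|$ denote the $L^2(\Omega)$ inner product and norm. $X=\{v\in H^1(\Omega)^d: v=0\text{ on }\partial\Omega\}$, $Q=\{q\in L^2(\Omega):\int_\Omega q\,dx=0\}$, $V=\{v\in X:(\nabla\cdot v,q)=0\ \forall q\in Q\}$ (the divergence-free subspace). $\nu>0$ is the viscosity, $f\in H^{-1}(\Omega)^d$ is the forcing, and $(f,v)=\langle f,v\rangle$ is the duality pairing. $b(u,w,v)=((u\cdot\nabla)w,v)$. A steady Navier-Stokes solution is a $u\in V$ with $\nu(\nabla u,\nabla v)+b(u,u,v)=\langle f,v\rangle$ for all $v\in V$ (it need not be unique; $u$ is the one from which the measurement data were obtained). The assumption $K_1<\infty$ is a standing assumption of the paper on the Navier-Stokes solutions considered. Data assimilation: $H>0$ is the width of a coarse mesh of $\Omega$, and $I_H$ is a (linear) coarse mesh interpolation operator for which there is a constant $C_I>0$ independent of $H$ with $\|I_Hv-v\|\le C_IH\|\nabla v\|$ and $\|I_Hv\|\le C_I\|v\|$ for all $v\in X$. $\mu>0$ is the nudging parameter. The known data are $u(x_i)+\epsilon_i$ at measurement points $x_i$; $\epsilon\in V$ is any divergence-free function with $I_H\epsilon(x_i)=\epsilon_i$, and $\delta\ge0$ denotes a relative noise size constant with $\|\nabla(u+\epsilon)\|\le(1+\delta)\|\nabla u\|$. *)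

(* Defs.v *)
From HB Require Import structures.
From mathcomp Require Import all_boot all_order all_algebra.
From mathcomp Require Import all_classical all_reals all_analysis.
Set Implicit Arguments.
Unset Strict Implicit.
Unset Printing Implicit Defensive.
Import Order.TTheory GRing.Theory Num.Theory.
Import numFieldNormedType.Exports.
Local Open Scope classical_set_scope.
Local Open Scope ring_scope.

Definition rV_display : measure_display. Proof. exact. Qed.

(* 'rV[R]_n carries the sigma-algebra generated by the coordinates, i.e. the
   Borel sets of R^n. *)
Section measurable_rV.
Context (R : realType) (n : nat).

Let coords : 'I_n -> 'rV[R]_n -> R := fun i x => x ord0 i.

Let rV_set0 : g_sigma_preimage coords set0.
Proof. exact: sigma_algebra0. Qed.

Let rV_setC A : g_sigma_preimage coords A -> g_sigma_preimage coords (~` A).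
Proof. exact: sigma_algebraC. Qed.

Let rV_bigcup (F : (set 'rV[R]_n)^nat) :
  (forall i, g_sigma_preimage coords (F i)) ->
  g_sigma_preimage coords (\bigcup_i (F i)).
Proof. exact: sigma_algebra_bigcup. Qed.

HB.instance Definition _ := @isMeasurable.Build rV_display
  'rV[R]_n (g_sigma_preimage coords) rV_set0 rV_setC rV_bigcup.

Lemma measurable_coord (i : 'I_n) :
  measurable_fun [set: 'rV[R]_n] (fun x : 'rV[R]_n => x ord0 i).
Proof.
move=> _ Y mY; rewrite setTI; apply: sub_sigma_algebra => /=.
rewrite -bigcup_seq/=; exists i => /=; first by rewrite mem_index_enum.
by exists Y => //; rewrite setTI.
Qed.

End measurable_rV.

Lemma measurable_fun_rV (R : realType) n d (T : measurableType d)
    (f : T -> 'rV[R]_n) :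
  (forall i, measurable_fun [set: T] (fun t => f t ord0 i)) ->
  measurable_fun [set: T] f.
Proof.
move=> mf; pose coords (i : 'I_n) (x : 'rV[R]_n) : R := x ord0 i.
suff H : g_sigma_preimage (fun i => coords i \o f) `<=` measurable.
  move=> _ A mA; apply: H; rewrite g_sigma_preimage_comp.
  by exists A.
apply: smallest_sub; first exact: sigma_algebra_measurable.
case: n f mf @coords => [|m] f mf coords; first by rewrite big_ord0.
rewrite -bigcup_mkord_ord; apply: bigcup_sub => i Ii.
by move=> A [B mB <-]; exact: mf.
Qed.

Section lebesgue_rV.
Context (R : realType).

Definition rV_cons n (p : measurableTypeR R * 'rV[R]_n) : 'rV[R]_n.+1 :=
  \row_i if unlift ord0 i is Some j then p.2 ord0 j else p.1.

Definition rV_uncons n (x : 'rV[R]_n.+1) : measurableTypeR R * 'rV[R]_n :=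
  (x ord0 ord0, \row_j x ord0 (lift ord0 j)).

Lemma rV_consK n : cancel (@rV_cons n) (@rV_uncons n).
Proof.
move=> [a x]; rewrite /rV_uncons /rV_cons !mxE unlift_none; congr pair.
by apply/rowP => j; rewrite !mxE liftK.
Qed.

Lemma measurable_rV_cons n : measurable_fun setT (@rV_cons n).
Proof.
apply: measurable_fun_rV => i.
case: (unliftP ord0 i) => [j ->|->].
  under eq_fun do rewrite /rV_cons mxE liftK.
  exact: measurableT_comp (measurable_coord j) measurable_snd.
under eq_fun do rewrite /rV_cons mxE unlift_none.
exact: measurable_fst.
Qed.

Lemma measurable_rV_uncons n : measurable_fun setT (@rV_uncons n).
Proof.
apply: measurable_fun_pair; first exact: (measurable_coord ord0).
apply: measurable_fun_rV => j.
under eq_fun do rewrite mxE.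
exact: (measurable_coord (lift ord0 j)).
Qed.

Definition leb_prod n (m : {sigma_finite_measure set 'rV[R]_n -> \bar R}) :
    {measure set (measurableTypeR R * 'rV[R]_n)%type -> \bar R} :=
  (@lebesgue_measure R \x m)%E.

Section step.
Context (n : nat) (m : {sigma_finite_measure set 'rV[R]_n -> \bar R}).

Definition leb_step : set 'rV[R]_n.+1 -> \bar R :=
  pushforward (leb_prod m) (@rV_cons n).

Let leb_step0 : leb_step set0 = 0%E.
Proof. exact: (@measure0 _ _ _ (leb_prod m)). Qed.

Let leb_step_ge0 A : (0 <= leb_step A)%E.
Proof. exact: (@measure_ge0 _ _ _ (leb_prod m)). Qed.

Let leb_step_semi_sigma_additive : semi_sigma_additive leb_step.
Proof.
have mc A : measurable A -> measurable (@rV_cons n @^-1` A).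
  by move=> mA; rewrite -[X in measurable X]setTI; exact: measurable_rV_cons.
move=> F mF tF mUF; rewrite /leb_step /pushforward preimage_bigcup.
apply: (@measure_semi_sigma_additive _ _ _ (leb_prod m)).
- by move=> i; exact: mc.
- apply/trivIsetP => /= i j _ _ ij; rewrite -preimage_setI.
  by move/trivIsetP : tF => /(_ _ _ _ _ ij) ->//; rewrite preimage_set0.
- by rewrite -preimage_bigcup; exact: mc.
Qed.

HB.instance Definition _ := isMeasure.Build _ _ _ leb_step
  leb_step0 leb_step_ge0 leb_step_semi_sigma_additive.

Let leb_step_sigma_finite : sigma_finite setT leb_step.
Proof.
have /sigma_finiteP[F [TF ndF Foo]] := sigma_finiteT (@lebesgue_measure R).
have /sigma_finiteP[G [TG ndG Goo]] := sigma_finiteT m.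
exists (fun i => @rV_uncons n @^-1` (F i `*` G i)).
  apply/esym/seteqP; split=> // x _.
  have : setT (rV_uncons x).1 by []. rewrite TF => -[i _ Fi].
  have : setT (rV_uncons x).2 by []. rewrite TG => -[j _ Gj].
  exists (maxn i j) => //; split.
    by move: Fi; exact/subsetPset/ndF/leq_maxl.
  by move: Gj; exact/subsetPset/ndG/leq_maxr.
move=> i; have [mFi Fi] := Foo i; have [mGi Gi] := Goo i.
have mFG : measurable (F i `*` G i) by exact: measurableX.
split.
  by rewrite -[X in measurable X]setTI; exact: measurable_rV_uncons.
rewrite /leb_step /pushforward -comp_preimage (_ : _ \o _ = id); last first.
  by apply/funext => p /=; rewrite rV_consK.
by rewrite /leb_prod /= product_measure1E// lte_mul_pinfty// ge0_fin_numE.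
Qed.

HB.instance Definition _ :=
  Measure_isSigmaFinite.Build _ _ _ leb_step leb_step_sigma_finite.

End step.

(* n-dimensional Lebesgue measure, by iterated product. *)
Fixpoint leb (n : nat) : {sigma_finite_measure set 'rV[R]_n -> \bar R} :=
  match n with
  | 0 => @dirac _ 'rV[R]_0 0 R
  | m.+1 => leb_step (leb m)
  end.

End lebesgue_rV.

Section calculus.
Context (R : realType) (d : nat).
Implicit Types (Omega : set 'rV[R]_d) (phi : 'rV[R]_d -> R).

Definition pderiv (j : 'I_d) phi : 'rV[R]_d -> R :=
  fun x => 'D_(delta_mx ord0 j) phi x.

Fixpoint Ck (k : nat) phi : Prop :=
  continuous phi /\
  if k is k'.+1 then
    forall j : 'I_d, (forall x, derivable phi x (delta_mx ord0 j)) /\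
                     Ck k' (pderiv j phi)
  else True.

Definition smooth phi := forall k, Ck k phi.

Definition test_fun Omega phi := smooth phi /\
  exists K, [/\ compact K, K `<=` Omega & forall x, ~ K x -> phi x = 0].

Definition rVdot (x y : 'rV[R]_d) : R := \sum_i x ord0 i * y ord0 i.

(* Open convex polygon (d = 2) or polyhedron (d = 3). *)
Definition convex_polygon Omega :=
  [/\ Omega !=set0, bounded_set Omega
    & exists (m : nat) (a : 'I_m -> 'rV[R]_d) (c : 'I_m -> R),
        Omega = [set x | forall i, rVdot (a i) x < c i]].

(* Near each boundary point, Omega is the sublevel set {g < 0} of a smooth g
   with nonvanishing gradient at that point. *)
Definition smooth_boundary Omega :=
  forall x, (closure Omega `\` interior Omega) x ->
  exists g : 'rV[R]_d -> R,
    [/\ smooth g, exists j, pderiv j g x != 0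
      & \forall y \near x, Omega y <-> g y < 0].

End calculus.

Section spaces.
Context (R : realType) (d : nat) (Omega : set 'rV[R]_d).
Notation leb := (leb R d).
Notation vfield := ('rV[R]_d -> 'rV[R]_d).
Notation mfield := ('rV[R]_d -> 'M[R]_d).

(* Elements of H^1(Omega)^d are handled together with their weak gradient, as
   pairs (v, grad v) with (grad v) i j = d v_i / d x_j. Both components are
   representatives, determined only almost everywhere on Omega. *)
Definition field_grad : Type := (vfield * mfield)%type.

HB.instance Definition _ := GRing.Lmodule.on field_grad.

Definition fval (v : field_grad) : vfield := v.1.
Definition grad (v : field_grad) : mfield := v.2.

(* L^2(Omega) for matrix-valued functions; vector fields are the case m = 1. *)
Definition L2 m n (F : 'rV[R]_d -> 'M[R]_(m, n)) :=
  forall i j, measurable_fun Omega (fun x => F x i j) /\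
              leb.-integrable Omega (fun x => ((F x i j) ^+ 2)%:E).

Definition ip m n (F G : 'rV[R]_d -> 'M[R]_(m, n)) : R :=
  \int[leb]_(x in Omega) (\sum_i \sum_j F x i j * G x i j).

Definition norm2 m n (F : 'rV[R]_d -> 'M[R]_(m, n)) : R := Num.sqrt (ip F F).

(* The L^infinity(Omega) norm of the pointwise Euclidean (Frobenius) norm. *)
Definition norm_infty m n (F : 'rV[R]_d -> 'M[R]_(m, n)) : \bar R :=
  'N[leb]_+oo[(fun x =>
     (Num.sqrt (\sum_i \sum_j F x i j ^+ 2))%:E) \_ Omega]%E.

Definition H1 : set field_grad := [set v |
  [/\ L2 (fval v), L2 (grad v)
    & forall (phi : 'rV[R]_d -> R) (i j : 'I_d), test_fun Omega phi ->
        \int[leb]_(x in Omega) (fval v x ord0 i * pderiv j phi x) =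
        - \int[leb]_(x in Omega) (grad v x i j * phi x)]].

Definition norm_H1 (v : field_grad) : R :=
  Num.sqrt (norm2 (fval v) ^+ 2 + norm2 (grad v) ^+ 2).

Definition classical_grad (phi : vfield) : field_grad :=
  (phi, fun x => \matrix_(i, j) pderiv j (fun y => phi y ord0 i) x).

(* v = 0 on the boundary, as membership in the H^1-closure of C_c^infty. *)
Definition X : set field_grad := [set v | H1 v /\
  exists phi : nat -> vfield,
    (forall n i, test_fun Omega (fun x => phi n x ord0 i)) /\
    (fun n => norm_H1 (v - classical_grad (phi n))) @ \oo --> (0 : R)].

Definition Q : set ('rV[R]_d -> R) := [set q : 'rV[R]_d -> R |
  [/\ measurable_fun Omega q,
      leb.-integrable Omega (fun x => ((q x) ^+ 2)%:E),
      leb.-integrable Omega (EFin \o q)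
    & \int[leb]_(x in Omega) q x = 0]].

Definition divergence (v : field_grad) : 'rV[R]_d -> R :=
  fun x => \tr (grad v x).

Definition V : set field_grad := [set v | X v /\
  forall q : 'rV[R]_d -> R, Q q -> \int[leb]_(x in Omega) (divergence v x * q x) = 0].

(* Row i of (u . nabla) w is \sum_j u_j (d w_i / d x_j). *)
Definition convect (u w : field_grad) : vfield :=
  fun x => fval u x *m (grad w x)^T.

Definition b (u w v : field_grad) : R := ip (convect u w) (fval v).

(* H^{-1}(Omega)^d: continuous linear functionals on X. *)
Definition Hm1 (f : field_grad -> R) :=
  (forall (a : R) v w, X v -> X w -> f (a *: v + w) = a * f v + f w) /\
  exists C : R, forall v, X v -> `|f v| <= C * norm_H1 v.

Definition steady_NS (nu : R) (f : field_grad -> R) (u : field_grad) :=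
  V u /\
  forall v, V v -> nu * ip (grad u) (grad v) + b u u v = f v.

Definition coarse_interpolant (CI H : R) (I : vfield -> vfield) :=
  [/\ forall v, X v -> L2 (I (fval v)),
      forall (a : R) v w, X v -> X w ->
        {ae leb, forall x, Omega x ->
           I (a *: fval v + fval w) x = a *: I (fval v) x + I (fval w) x},
      forall v, X v ->
        norm2 (I (fval v) - fval v) <= CI * H * norm2 (grad v)
    & forall v, X v -> norm2 (I (fval v)) <= CI * norm2 (fval v)].

Definition CDA_Picard (nu mu : R) (f : field_grad -> R)
    (I : vfield -> vfield) (u eps : field_grad) (u_ : nat -> field_grad) :=
  (forall k, V (u_ k)) /\
  forall k v, V v ->
    nu * ip (grad (u_ k.+1)) (grad v) + b (u_ k) (u_ k.+1) v
      + mu * ip (I (fval (u_ k.+1)) - I (fval (u + eps))) (I (fval v))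
    = f v.

End spaces.

Definition lambda_bar (R : realType) (nu CI H mu : R) : R :=
  Num.min (nu / (CI ^+ 2 * H ^+ 2)) (mu / 2).

(* Main.v *)
Require Import Defs.
From HB Require Import structures.
From mathcomp Require Import all_boot all_order all_algebra.
From mathcomp Require Import all_classical all_reals all_analysis.
From mathcomp Require Import measurable_realfun ess_sup_inf ring lra.
Set Implicit Arguments.
Unset Strict Implicit.
Unset Printing Implicit Defensive.
Import Order.TTheory GRing.Theory Num.Theory.
Import numFieldNormedType.Exports.
Local Open Scope classical_set_scope.
Local Open Scope ring_scope.

(** The error e_k = u_k - u is controlled by testing the difference of the two
variational equations with e_{k+1}. The convective difference splits as
b(u_k, e_{k+1}, e_{k+1}) + b(e_k, u, e_{k+1}); the first term vanishes because
u_k is divergence free, the second is at most K1 |e_k| |e_{k+1}|. Hence, with G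
the norm of the gradient of e_{k+1} and J, eta those of I_H e_{k+1} and
I_H eps,
  nu G^2 + mu J^2 <= mu eta J + K1 |e_k| (C_I H G + J),
where |e_{k+1}| <= J + C_I H G is the approximation property of I_H. The
conditions on H and mu make the right-hand side absorbable
([energy_absorption]), and 2 nu G^2 + mu J^2 dominates lambda |e_{k+1}|^2
([lambda_bar_energy]), so lambda |e_{k+1}|^2 <= 2 |e_k|^2 + 2 mu eta^2. Solving
this recursion ([geometric_recursion]) gives both bounds.

The analytic content is the identity b(u, w, w) = 0 for u in V and w in X
([b_skew]): the trilinear integrand has to be integrable, and the identity has
to survive the passage from smooth w to w in X. Both rest on the embedding of
H^1_0 into L^4 in dimension 2 and 3. For a compactly supported C^1 function phi
it comes from phi(x)^2 <= \int |d_j (phi^2)| along each coordinate line: in the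
plane, multiplying the two bounds and integrating gives
  \int phi^4 <= 2 (\int phi^2) (\int |grad phi|^2)    ([ladyzhenskaya2]),
and in space one applies this on every slice, bounding the L^2 norm of the
slice by the same device in the remaining direction ([ladyzhenskaya_step]). The
inequality passes to the limit in H^1_0 by truncation ([H10_pow4_le]).

For a test function phi, the definition of the weak gradient, applied to
phi^2, gives 2 \int (u . grad phi) phi = - \int (div u) phi^2. The right-hand
side vanishes ([integral_divergence_test]), although the constraint defining V
only concerns functions of mean zero: phi^2 is corrected by a multiple of the
indicator of a set A. If Omega has finite measure, A = Omega works since the
flux of u is zero; otherwise A may be taken arbitrarily large and the
correction tends to zero. *)

(** * Square-integrable functions *)

(** A quadratic polynomial in t that is nonnegative everywhere has nonpositive
discriminant; all the Cauchy-Schwarz inequalities below are instances. *)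
Lemma discriminant_le (R : realFieldType) (A B C : R) : 0 <= C ->
  (forall t, 0 <= A + 2 * t * B + t ^+ 2 * C) -> B ^+ 2 <= A * C.
Proof.
rewrite le_eqVlt => /predU1P[<- H|C0 H].
  rewrite mulr0; have [->|B0] := eqVneq B 0; first by rewrite expr0n.
  have := H (- (A + 1) / (2 * B)).
  rewrite mulr0 addr0 (_ : 2 * _ * B = - (A + 1)); last by field.
  by rewrite opprD addrA subrr add0r ler0N1.
have := H (- B / C).
rewrite (_ : _ + _ = A - B ^+ 2 / C); last by field; rewrite gt_eqF.
by rewrite subr_ge0 ler_pdivrMr.
Qed.

Section square_integrable.
Context d (T : measurableType d) (R : realType).
Context (mu : {measure set T -> \bar R}) (D : set T).
Hypothesis mD : measurable D.
Implicit Types f g h : T -> R.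

Definition sqint f :=
  measurable_fun D f /\ mu.-integrable D (fun x => (f x ^+ 2)%:E).

Lemma le_integrable_real f g : measurable_fun D f ->
  (forall x, D x -> `|f x| <= g x) ->
  mu.-integrable D (EFin \o g) -> mu.-integrable D (EFin \o f).
Proof.
move=> mf fg ig; apply: (le_integrable mD _ _ ig).
  exact/measurable_EFinP.
move=> x Dx; rewrite /= lee_fin (le_trans (fg _ Dx))//.
exact: ler_norm.
Qed.

Lemma integrable_addr f g : mu.-integrable D (EFin \o f) ->
  mu.-integrable D (EFin \o g) -> mu.-integrable D (EFin \o (fun x => f x + g x)).
Proof. by move=> if_ ig; have := integrableD mD if_ ig. Qed.

Lemma integrable_subr f g : mu.-integrable D (EFin \o f) ->
  mu.-integrable D (EFin \o g) -> mu.-integrable D (EFin \o (fun x => f x - g x)).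
Proof. by move=> if_ ig; have := integrableB mD if_ ig. Qed.

Lemma integrable_scale a f : mu.-integrable D (EFin \o f) ->
  mu.-integrable D (EFin \o (fun x => a * f x)).
Proof. by move=> if_; have := integrableZl mD a if_. Qed.

Lemma integrable_bigsum (I : finType) (F : I -> T -> R) :
  (forall i, mu.-integrable D (EFin \o F i)) ->
  mu.-integrable D (EFin \o (fun x => \sum_i F i x)).
Proof.
move=> iF; rewrite (_ : _ \o _ = fun x => (\sum_i (F i x)%:E)%E).
  by apply: integrable_sum => // i _; exact: iF.
by apply/funext => x /=; rewrite sumEFin.
Qed.

Lemma Rintegral_sum (I : finType) (F : I -> T -> R) :
  (forall i, mu.-integrable D (EFin \o F i)) ->
  \int[mu]_(x in D) (\sum_i F i x) = \sum_i \int[mu]_(x in D) F i x.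
Proof.
move=> iF; rewrite /Rintegral.
under eq_integral do rewrite -sumEFin.
rewrite integral_sum// sum_fine// => i _.
by apply: integrable_fin_num => //; exact: iF.
Qed.

Lemma sqint_mul f g : sqint f -> sqint g ->
  mu.-integrable D (EFin \o (fun x => f x * g x)).
Proof.
move=> [mf f2] [mg g2].
apply: (@le_integrable_real _ (fun x => f x ^+ 2 + g x ^+ 2)).
- exact: measurable_funM.
- move=> x _; rewrite normrM -[f x ^+ 2]real_normK ?num_real//.
  rewrite -[g x ^+ 2]real_normK ?num_real//.
  set a := `|f x|; set c := `|g x|.
  by have := normr_ge0 (f x); have := normr_ge0 (g x); rewrite -/a -/c; nra.
- exact: integrable_addr.
Qed.

Lemma sqint_le f g : measurable_fun D f -> (forall x, D x -> `|f x| <= `|g x|) ->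
  sqint g -> sqint f.
Proof.
move=> mf fg [mg g2]; split => //.
apply: (@le_integrable_real _ (fun x => g x ^+ 2)) => //.
  by under eq_fun do rewrite expr2; exact: measurable_funM.
move=> x Dx; rewrite ger0_norm ?sqr_ge0//.
by rewrite -(real_normK (num_real (f x))) -(real_normK (num_real (g x)))
  lerXn2r ?nnegrE// fg.
Qed.

Lemma sqintD f g : sqint f -> sqint g -> sqint (fun x => f x + g x).
Proof.
move=> sf sg; split; first by apply: measurable_funD; [case: sf|case: sg].
have -> : (fun x => ((f x + g x) ^+ 2)%:E) = EFin \o (fun x => f x ^+ 2 +
    (2 * (f x * g x) + g x ^+ 2)).
  by apply/funext => x /=; congr EFin; ring.
apply: integrable_addr; first exact: sf.2.
apply: integrable_addr; last exact: sg.2.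
by apply: integrable_scale; exact: sqint_mul.
Qed.

Lemma sqintZ a f : sqint f -> sqint (fun x => a * f x).
Proof.
move=> sf; split; first by apply: measurable_funM; [exact: measurable_cst|case: sf].
have -> : (fun x => ((a * f x) ^+ 2)%:E) = EFin \o (fun x => a ^+ 2 * f x ^+ 2).
  by apply/funext => x /=; congr EFin; ring.
apply: integrable_scale; exact: sf.2.
Qed.

Lemma sqintB f g : sqint f -> sqint g -> sqint (fun x => f x - g x).
Proof.
move=> sf sg; under eq_fun => x do rewrite -mulN1r.
by apply: sqintD => //; exact: sqintZ.
Qed.

Lemma sqint0 : sqint (fun=> 0).
Proof.
split; first exact: measurable_cst.
by under eq_fun do rewrite expr0n /=; exact: integrable0.
Qed.

Lemma sqint_sum (I : finType) (F : I -> T -> R) :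
  (forall i, sqint (F i)) -> sqint (fun x => \sum_i F i x).
Proof.
move=> sF; elim: (index_enum I) => [|i s ih].
  by under eq_fun do rewrite big_nil; exact: sqint0.
by under eq_fun do rewrite big_cons; exact: sqintD.
Qed.

Lemma sqint_norm f : sqint f -> sqint (fun x => `|f x|).
Proof.
move=> sf; apply: (sqint_le _ _ sf); first by apply: measurableT_comp => //; exact: sf.1.
by move=> x _; rewrite normr_id.
Qed.

Lemma cauchy_schwarz_Rintegral f g : sqint f -> sqint g ->
  (\int[mu]_(x in D) (f x * g x)) ^+ 2 <=
  \int[mu]_(x in D) (f x ^+ 2) * \int[mu]_(x in D) (g x ^+ 2).
Proof.
move=> sf sg; apply: discriminant_le => [|t].
  by apply: Rintegral_ge0 => x _; exact: sqr_ge0.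
have iff : mu.-integrable D (EFin \o (fun x => f x ^+ 2)) by exact: sf.2.
have igg : mu.-integrable D (EFin \o (fun x => g x ^+ 2)) by exact: sg.2.
have ifg := sqint_mul sf sg.
have ifg2 := integrable_scale (2 * t) ifg.
have igg2 := integrable_scale (t ^+ 2) igg.
rewrite -(RintegralZl _ _ ifg)// -(RintegralZl _ _ igg)// -RintegralD//.
rewrite -RintegralD//; last exact: integrable_addr.
apply: Rintegral_ge0 => x Dx.
rewrite (_ : _ + _ = (f x + t * g x) ^+ 2) ?sqr_ge0//; ring.
Qed.

Lemma cauchy_schwarz_norm f g : sqint f -> sqint g ->
  (\int[mu]_(x in D) `|f x * g x|) ^+ 2 <=
  \int[mu]_(x in D) (f x ^+ 2) * \int[mu]_(x in D) (g x ^+ 2).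
Proof.
move=> sf sg.
have := cauchy_schwarz_Rintegral (sqint_norm sf) (sqint_norm sg).
under eq_Rintegral do rewrite -normrM.
under [in X in _ <= X * _]eq_Rintegral do rewrite real_normK ?num_real//.
by under [in X in _ <= _ * X]eq_Rintegral do rewrite real_normK ?num_real//.
Qed.

Lemma normr_Rintegral_le f g : measurable_fun D f ->
  (forall x, D x -> `|f x| <= g x) -> mu.-integrable D (EFin \o g) ->
  `|\int[mu]_(x in D) f x| <= \int[mu]_(x in D) g x.
Proof.
move=> mf fg ig; have if_ := le_integrable_real mf fg ig.
apply: (le_trans (le_normr_Rintegral mD if_)).
apply: le_Rintegral => //; exact: integrable_norm.
Qed.

End square_integrable.

(** * Lebesgue measure on row vectors: Borel sets and slices *)

Section measurable_slices.
Context (R : realType).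

Definition open_cube n (q : 'rV[R]_n) (e : R) : set 'rV[R]_n :=
  [set x | forall i, `|x ord0 i - q ord0 i| < e].

Lemma measurable_open_cube n (q : 'rV[R]_n) e : measurable (open_cube q e).
Proof.
have -> : open_cube q e =
    \bigcap_(i in [set: 'I_n]) ((fun x : 'rV[R]_n => x ord0 i) @^-1`
      [set t : R | `|t - q ord0 i| < e]).
  by apply/seteqP; split=> [x Hx i _|x Hx i]; [exact: Hx|exact: (Hx i)].
apply: fin_bigcap_measurable => // i _.
rewrite -[X in measurable X]setTI; apply: measurable_coord => //.
have -> : [set t : R | `|t - q ord0 i| < e] = ball (q ord0 i) e.
  by apply/seteqP; split => t /=; rewrite /ball/= distrC.
exact: measurable_ball.
Qed.

(** An open set is a countable union of cubes with rational centres and radii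
1/(k+1), and each cube is a finite intersection of preimages of balls by
coordinates. *)
Lemma open_measurable_rV n (A : set 'rV[R]_n) : open A -> measurable A.
Proof.
move=> oA.
pose F (p : 'rV[rat]_n * nat) : set 'rV[R]_n :=
  if `[< open_cube (map_mx ratr p.1) p.2.+1%:R^-1 `<=` A >]
  then open_cube (map_mx ratr p.1) p.2.+1%:R^-1 else set0.
have -> : A = \bigcup_p F p; last first.
  apply: countable_bigcupT_measurable => [|p].
    exact: countableP.
  rewrite /F; case: asboolP => _; [exact: measurable_open_cube|exact: measurable0].
apply/seteqP; split => [x Ax|x [p _ Fpx]]; last first.
  by move: Fpx; rewrite /F; case: asboolP => // sA /sA.
have /nbhs_ballP[e /= e0 eA] : nbhs x A by exact: open_nbhs_nbhs.
have [k ke] : exists k : nat, 2 * k.+1%:R^-1 < e.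
  have e20 : 0 < e / 2 by rewrite divr_gt0.
  have [k /= kP] := filter_ex (near_infty_natSinv_lt (PosNum e20)).
  have {}kP : k.+1%:R^-1 < e / 2 := kP.
  by exists k; rewrite -ltr_pdivlMl// mulrC.
(* a rational point within the radius of x in every coordinate *)
have Hq i : {q : rat | `|x ord0 i - ratr q| < k.+1%:R^-1 :> R}.
  apply/cid; have k0 : 0 < k.+1%:R^-1 :> R by rewrite invr_gt0.
  move: k0; set a := _^-1 => k0.
  have /rat_in_itvoo[q] : x ord0 i - a < x ord0 i + a by lra.
  rewrite in_itv/= => /andP[q1 q2]; exists q.
  by rewrite ltr_norml; apply/andP; split; lra.
pose q : 'rV[rat]_n := \row_i sval (Hq i).
exists (q, k) => //; rewrite /F; case: asboolP => [_ i /=|Hn].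
  by rewrite !mxE; exact: (svalP (Hq i)).
exfalso; apply: Hn => y Hy; apply: eA; split => // i j.
rewrite ord1 /ball/=.
have := Hy j; rewrite !mxE /= => yj; have /= xj := svalP (Hq j).
rewrite (le_lt_trans _ ke)//.
rewrite (_ : x _ _ - y _ _ = (x ord0 j - ratr (sval (Hq j))) -
   (y ord0 j - ratr (sval (Hq j)))); last by ring.
rewrite (le_trans (ler_normB _ _))// mulr_natl mulr2n.
exact: lerD (ltW _) (ltW _).
Qed.

Lemma continuous_measurable_rV n (f : 'rV[R]_n -> R) :
  continuous f -> measurable_fun setT f.
Proof.
move=> /continuousP cf; apply: (measurability _ (RGenOpens.measurableE R)).
move=> _ [_ [a [b ->] <-]]; rewrite setTI; apply: open_measurable_rV.
exact/cf/interval_open.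
Qed.

(** Tonelli's theorem for the iterated product that defines [leb]: the first
coordinate is integrated last, and first in [integral_leb_cons_swap]. *)
Lemma integral_leb_cons n (f : 'rV[R]_n.+1 -> \bar R) :
  measurable_fun setT f -> (forall x, 0 <= f x)%E ->
  (\int[leb R n.+1]_x f x =
   \int[lebesgue_measure]_s \int[leb R n]_y f (rV_cons (s, y)))%E.
Proof.
move=> mf f0.
transitivity (\int[leb_prod (leb R n)]_p f (rV_cons p))%E.
  have := @ge0_integral_pushforward _ _ _ _ R _ (@measurable_rV_cons R n)
    (leb_prod (leb R n)) setT f measurableT mf (fun y _ => f0 y).
  by rewrite preimage_setT.
rewrite /leb_prod fubini_tonelli1//.
by apply: measurableT_comp => //; exact: measurable_rV_cons.
Qed.

Lemma measurable_rV_cons1 n s : measurable_fun setT (fun y : 'rV[R]_n => rV_cons (s, y)).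
Proof.
apply: measurableT_comp; first exact: measurable_rV_cons.
exact: measurable_pair1.
Qed.

Lemma integral_leb_cons_swap n (f : 'rV[R]_n.+1 -> \bar R) :
  measurable_fun setT f -> (forall x, 0 <= f x)%E ->
  (\int[leb R n.+1]_x f x =
   \int[leb R n]_y \int[lebesgue_measure]_s f (rV_cons (s, y)))%E.
Proof.
move=> mf f0; rewrite integral_leb_cons//.
rewrite (fubini_tonelli (fun p => f (rV_cons p)))//.
by apply: measurableT_comp => //; exact: measurable_rV_cons.
Qed.

Lemma measurable_integral_cons n (f : 'rV[R]_n.+1 -> \bar R) :
  measurable_fun setT f -> (forall x, 0 <= f x)%E ->
  measurable_fun setT (fun s : measurableTypeR R => (\int[leb R n]_y f (rV_cons (s, y)))%E).
Proof.
move=> mf f0.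
apply: (measurable_fun_fubini_tonelli_F (fun p => f (rV_cons p))) => //.
by apply: measurableT_comp => //; exact: measurable_rV_cons.
Qed.

Lemma measurable_integral_cons_swap n (f : 'rV[R]_n.+1 -> \bar R) :
  measurable_fun setT f -> (forall x, 0 <= f x)%E ->
  measurable_fun setT (fun y : 'rV[R]_n =>
    (\int[lebesgue_measure]_s f (rV_cons (s, y)))%E).
Proof.
move=> mf f0.
apply: (measurable_fun_fubini_tonelli_G (fun p => f (rV_cons p))) => //.
by apply: measurableT_comp => //; exact: measurable_rV_cons.
Qed.

Lemma leb_open_cube n (r : R) : 0 <= r ->
  leb R n (open_cube 0 r) = ((2 * r) ^+ n)%:E.
Proof.
move=> r0; elim: n => [|n IH].
  rewrite expr0 /= /dirac/= indicE mem_set// => -[].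
  done.
have -> : leb R n.+1 (open_cube 0 r) =
    leb_prod (leb R n) (ball (0:R) r `*` open_cube (0 : 'rV[R]_n) r).
  rewrite /= /leb_step /pushforward; congr (leb_prod _ _).
  apply/seteqP; split => [[s y]|[s y] [/= s1 y1]] /= H.
    split; first by have := H ord0; rewrite mxE unlift_none mxE subr0 /ball/= sub0r normrN.
    by move=> i /=; have := H (lift ord0 i); rewrite mxE liftK !mxE.
  case: (unliftP ord0 H) => [j ->|->]; rewrite !mxE.
    by rewrite liftK; have := y1 j; rewrite mxE.
  by rewrite unlift_none subr0; move: s1; rewrite /ball/= sub0r normrN.
rewrite /leb_prod /= product_measure1E//; last 2 first.
- exact: measurable_ball.
- exact: measurable_open_cube.
rewrite IH.
rewrite [X in (X * _)%E](_ : _ = (2 * r)%:E); last first.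
  by rewrite mulr_natl; exact: lebesgue_measure_ball.
by rewrite -EFinM exprS.
Qed.

End measurable_slices.

(** * Compactly supported C^1 functions and their slices *)

Section C1_compact_support.
Context (R : realType).

(** Support contained in a cube rather than in a compact set, so that slices
inherit the property coordinate by coordinate. *)
Definition cube_supported n (f : 'rV[R]_n -> R) :=
  exists2 r : R, 0 <= r & forall x, ~ open_cube 0 r x -> f x = 0.

Definition Cc n (f : 'rV[R]_n -> R) := continuous f /\ cube_supported f.

Definition C1c n (f : 'rV[R]_n -> R) := Ck 1 f /\ cube_supported f.

Lemma not_open_cube n (r : R) (x : 'rV[R]_n) :
  ~ open_cube 0 r x <-> exists i, r <= `|x ord0 i|.
Proof.
split => [/existsNP[i Hi]|[i Hi] /(_ i)].
  by exists i; rewrite leNgt; apply/negP => H; apply: Hi; rewrite mxE subr0.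
by rewrite mxE subr0 ltNge Hi.
Qed.

Lemma Cc_integrable n (f : 'rV[R]_n -> R) : Cc f ->
  (leb R n).-integrable setT (EFin \o f).
Proof.
move=> [cf [r r0 fr]].
have mC := @measurable_open_cube R n 0 r.
have mf := continuous_measurable_rV cf.
rewrite (_ : EFin \o f = (EFin \o f) \_ (open_cube 0 r)); last first.
  apply/funext => x; rewrite patchE; case: ifPn => // /negP xN /=.
  by rewrite fr// => H; apply: xN; rewrite inE.
apply/(integrable_mkcond _ mC).
apply: measurable_bounded_integrable => //.
- have H : (leb R n (open_cube 0 r) < +oo)%E by rewrite leb_open_cube// ltry.
  exact: H.
- exact: measurable_funTS.
pose K := [set v : 'rV[R]_n | forall i, v ord0 i \in `[(- r), r]].
have cK : compact K.
  apply: (@rV_compact _ _ (fun=> `[(- r), r]%classic)).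
  by move=> _; apply: segment_compact.
have : compact (f @` K) by apply: continuous_compact => //; exact: continuous_subspaceT.
move=> /compact_bounded[M [Mr HM]]; exists M; split => // x Mx y Cy /=.
apply: (HM _ Mx); exists y => // i.
by have := Cy i; rewrite mxE subr0 in_itv/= -ler_norml => /ltW.
Qed.

Lemma CcM n (f g : 'rV[R]_n -> R) : continuous f -> Cc g -> Cc (fun x => f x * g x).
Proof.
move=> cf [cg [r r0 gr]]; split; first by move=> x; exact: (cvgM (cf x) (cg x)).
by exists r => // x /gr ->; rewrite mulr0.
Qed.

Lemma C1c_Cc n (f : 'rV[R]_n -> R) : C1c f -> Cc f.
Proof. by move=> [[cf _] sf]. Qed.

Lemma C1c_derivable n (f : 'rV[R]_n -> R) j x : C1c f ->
  derivable f x (delta_mx ord0 j).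
Proof. by move=> [[_ /(_ j)[]]]. Qed.

(** The cube is enlarged by 1: at its boundary the function need not vanish in
a whole neighbourhood. *)
Lemma pderiv_cube_supported n (f : 'rV[R]_n -> R) j :
  cube_supported f -> cube_supported (pderiv j f).
Proof.
move=> [r r0 fr]; exists (r + 1) => [|x]; first by rewrite addr_ge0.
move=> /not_open_cube[i ri].
have f0 : \forall y \near x, f y = cst 0 y.
  have /cvgr_dist_lt/(_ _ (@ltr01 R)) := @coord_continuous R 1 n ord0 i x.
  apply: filterS => y xy; apply: fr; apply/not_open_cube; exists i.
  have := ler_normD (x ord0 i - y ord0 i) (y ord0 i); rewrite subrK.
  by move: xy => /=; lra.
by rewrite /pderiv (near_eq_derive _ f0) derive_cst.
Qed.

Lemma C1c_pderiv n (f : 'rV[R]_n -> R) j : C1c f -> Cc (pderiv j f).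
Proof. by move=> [[_ /(_ j)[_ []]]] cf _ ?; split => //; exact: pderiv_cube_supported. Qed.

Lemma pderiv_sqr n (f : 'rV[R]_n -> R) j x : derivable f x (delta_mx ord0 j) ->
  pderiv j (fun x => f x ^+ 2) x = 2 * (f x * pderiv j f x).
Proof.
move=> df; rewrite /pderiv.
rewrite (_ : (fun x => _) = f * f); last by apply/funext => y; rewrite expr2.
rewrite deriveM// /GRing.scale /=; ring.
Qed.

Lemma C1c_sqr n (f : 'rV[R]_n -> R) : C1c f -> C1c (fun x => f x ^+ 2).
Proof.
move=> Cf; have [[cf df] [r r0 fr]] := Cf.
have Ef : (fun x => f x ^+ 2) = f * f by apply/funext => y; rewrite expr2.
split; last by exists r => // x /fr ->; rewrite expr0n.
split; first by move=> x; rewrite Ef; exact: (cvgM (cf x) (cf x)).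
move=> j; split=> [x|].
  by rewrite Ef; apply: derivableM; exact: C1c_derivable.
split => //.
have -> : pderiv j (fun x => f x ^+ 2) = fun x => 2 * (f x * pderiv j f x).
  by apply/funext => x; rewrite pderiv_sqr//; exact: C1c_derivable.
have [_ [c1 _]] := df j.
by move=> x; exact: (cvgM (cvg_cst (2 : R)) (cvgM (cf x) (c1 x))).
Qed.

Lemma continuous_rV_cons1 n s : continuous (fun y : 'rV[R]_n => rV_cons (s, y)).
Proof.
move=> y A /nbhs_ballP[e /= e0 eA]; apply/nbhs_ballP; exists e => //= z [_ yz].
apply: eA; split => // i j; rewrite !mxE.
case: (unliftP ord0 j) => [k _|_]; last exact: ballxx.
exact: yz.
Qed.

Lemma continuous_rV_cons2 n (y : 'rV[R]_n) :
  continuous (fun s : R => rV_cons (s : measurableTypeR R, y)).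
Proof.
move=> s A /nbhs_ballP[e /= e0 eA]; apply/nbhs_ballP; exists e => //= t st.
apply: eA; split => // i j; rewrite !mxE.
by case: (unliftP ord0 j) => [k _|_]; [exact: ballxx|].
Qed.

(** Moving along a coordinate axis commutes with taking a slice, so the partial
derivatives of a slice are the slices of the partial derivatives. *)
Lemma rV_cons_shift1 n (s : measurableTypeR R) (y : 'rV[R]_n) j (h : R) :
  rV_cons (s, h *: delta_mx ord0 j + y) =
  h *: delta_mx ord0 (lift ord0 j) + rV_cons (s, y).
Proof.
apply/rowP => i; rewrite !mxE.
case: (unliftP ord0 i) => [k ->|->]; first by rewrite !mxE (inj_eq lift_inj).
by rewrite (negbTE (neq_lift _ _)) andbF mulr0 add0r.
Qed.

Lemma rV_cons_shift2 n (s : measurableTypeR R) (y : 'rV[R]_n) (h : R) :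
  rV_cons ((h *: (1 : R) + s : R) : measurableTypeR R, y) =
  h *: delta_mx ord0 ord0 + rV_cons (s, y).
Proof.
apply/rowP => i; rewrite !mxE.
case: (unliftP ord0 i) => [k ->|->]; last by rewrite !eqxx.
by rewrite (eq_sym (lift _ _)) (negbTE (neq_lift _ _)) andbF mulr0 add0r.
Qed.

Lemma cube_supported_cons1 n (f : 'rV[R]_n.+1 -> R) s :
  cube_supported f -> cube_supported (fun y => f (rV_cons (s, y))).
Proof.
move=> [r r0 fr]; exists r => // y /not_open_cube[i Hi]; apply: fr.
by apply/not_open_cube; exists (lift ord0 i); rewrite mxE liftK.
Qed.

Lemma derivable_cons1 n (f : 'rV[R]_n.+1 -> R) s y j :
  derivable f (rV_cons (s, y)) (delta_mx ord0 (lift ord0 j)) ->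
  derivable (fun y => f (rV_cons (s, y))) y (delta_mx ord0 j).
Proof.
rewrite /derivable; set F := (X in cvg (X @ _) -> _).
set G := (X in _ -> cvg (X @ _)); suff -> : F = G by [].
by apply/funext => h; rewrite /F /G /= rV_cons_shift1.
Qed.

Lemma pderiv_cons1 n (f : 'rV[R]_n.+1 -> R) s y j :
  pderiv j (fun y => f (rV_cons (s, y))) y = pderiv (lift ord0 j) f (rV_cons (s, y)).
Proof.
rewrite /pderiv /derive; set F := (X in lim (X @ _) = _).
set G := (X in _ = lim (X @ _)); suff -> : F = G by [].
by apply/funext => h; rewrite /F /G /= rV_cons_shift1.
Qed.

Lemma C1c_cons1 n (f : 'rV[R]_n.+1 -> R) s :
  C1c f -> C1c (fun y => f (rV_cons (s, y))).
Proof.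
move=> [[cf df] sf]; split; last exact: cube_supported_cons1.
split; first by move=> y; apply: continuous_comp; [exact: continuous_rV_cons1|exact: cf].
move=> j; have [d1 [c1 _]] := df (lift ord0 j); split => [y|].
  exact/derivable_cons1.
split => //; rewrite (_ : pderiv _ _ = fun y => pderiv (lift ord0 j) f (rV_cons (s, y))).
  by move=> y; apply: continuous_comp; [exact: continuous_rV_cons1|exact: c1].
by apply/funext => y; rewrite pderiv_cons1.
Qed.

Lemma derivable_cons2 n (f : 'rV[R]_n.+1 -> R) (s : R) y :
  derivable f (rV_cons (s : measurableTypeR R, y)) (delta_mx ord0 ord0) ->
  derivable (fun s : R => f (rV_cons (s : measurableTypeR R, y))) s 1.
Proof.
rewrite /derivable; set F := (X in cvg (X @ _) -> _).
set G := (X in _ -> cvg (X @ _)); suff -> : F = G by [].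
by apply/funext => h; rewrite /F /G /= rV_cons_shift2.
Qed.

Lemma derive1_cons2 n (f : 'rV[R]_n.+1 -> R) (s : R) y :
  ((fun s : R => f (rV_cons (s : measurableTypeR R, y)))^`())%classic s =
  pderiv ord0 f (rV_cons (s : measurableTypeR R, y)).
Proof.
rewrite derive1E /pderiv /derive; set F := (X in lim (X @ _) = _).
set G := (X in _ = lim (X @ _)); suff -> : F = G by [].
by apply/funext => h; rewrite /F /G /= rV_cons_shift2.
Qed.

Lemma FTC_cons n (f : 'rV[R]_n.+1 -> R) (a b : R) y : C1c f -> a < b ->
  (\int[lebesgue_measure]_(t in `[a, b])
     (pderiv ord0 f (rV_cons (t : measurableTypeR R, y)))%:E =
   (f (rV_cons (b : measurableTypeR R, y)))%:E -
   (f (rV_cons (a : measurableTypeR R, y)))%:E)%E.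
Proof.
move=> [[cf df] sf] ab; have [d1 [c1 _]] := df ord0.
have cg : continuous (fun s : R => f (rV_cons (s : measurableTypeR R, y))).
  by move=> s; apply: continuous_comp; [exact: continuous_rV_cons2|exact: cf].
apply: (continuous_FTC2 ab (F := fun s : R => f (rV_cons (s : measurableTypeR R, y)))).
- apply: continuous_subspaceT => s.
  by apply: continuous_comp; [exact: continuous_rV_cons2|exact: c1].
- split.
  + by move=> s _; apply: derivable_cons2; exact: d1.
  + by apply: cvg_at_right_filter; exact: cg.
  + by apply: cvg_at_left_filter; exact: cg.
- by move=> s _; exact: derive1_cons2.
Qed.

End C1_compact_support.

(** * Ladyzhenskaya's inequality *)

Section ladyzhenskaya.
Context (R : realType).

Lemma EFin_Rintegral d (T : measurableType d) (mu : {measure set T -> \bar R}) D (f : T -> R) :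
  measurable D -> mu.-integrable D (EFin \o f) ->
  (\int[mu]_(x in D) f x)%R%:E = (\int[mu]_(x in D) (f x)%:E)%E.
Proof. by move=> mD if_; rewrite /Rintegral fineK//; exact: integrable_fin_num. Qed.

Lemma continuous_pderiv_cons2 n (f : 'rV[R]_n.+1 -> R) j y : C1c f ->
  continuous (fun t : R => pderiv j f (rV_cons (t : measurableTypeR R, y))).
Proof.
move=> Cf s; have [c1 _] := C1c_pderiv j Cf.
by apply: continuous_comp; [exact: continuous_rV_cons2|exact: c1].
Qed.

(** The fundamental theorem of calculus from the edge of the support, where the
function is zero. *)
Lemma norm_le_integral_pderiv n (f : 'rV[R]_n.+1 -> R) (s : R) y : C1c f ->
  (`|f (rV_cons (s : measurableTypeR R, y))|%:E <=
   \int[lebesgue_measure]_t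
     `|pderiv ord0 f (rV_cons (t : measurableTypeR R, y))|%:E)%E.
Proof.
move=> Cf; have [_ [r r0 fr]] := Cf.
have cd := @continuous_pderiv_cons2 n f ord0 y Cf.
have mg := continuous_measurable_fun cd.
have [sr|rs] := ltP `|s| r; last first.
  rewrite fr ?normr0; first by apply: integral_ge0 => t _; rewrite lee_fin.
  by apply/not_open_cube; exists ord0; rewrite mxE unlift_none.
have rs : - r < s by move: sr; rewrite ltr_norml => /andP[].
have := FTC_cons y Cf rs.
rewrite [X in (_ - X)%E](_ : _ = 0%E); last first.
  rewrite fr//; apply/not_open_cube; exists ord0.
  by rewrite mxE unlift_none normrN ger0_norm.
rewrite sube0 => fE.
rewrite [leLHS](_ : _ = `|(f (rV_cons (s : measurableTypeR R, y)))%:E|%E)// -fE.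
apply: (le_trans (le_abse_integral _ _ _)) => //.
  by apply/measurable_EFinP; exact: measurable_funTS.
apply: ge0_subset_integral => //.
by do 2 apply: measurableT_comp => //.
Qed.

Lemma integral_pderiv_cons2 n (f : 'rV[R]_n.+1 -> R) y : C1c f ->
  (\int[lebesgue_measure]_t
     (pderiv ord0 f (rV_cons (t : measurableTypeR R, y)))%:E = 0)%E.
Proof.
move=> Cf; have [_ [r r0 fr]] := Cf.
have [_ [r' r'0 dfr]] := C1c_pderiv ord0 Cf.
(* [-a, a] contains the supports of f and of its derivative in its interior *)
pose a := r + r' + 1; have a0 : - a < a by rewrite /a; lra.
have aE : `|a| = a by rewrite ger0_norm// /a; lra.
have := FTC_cons y Cf a0.
rewrite !fr ?subee//; last 2 first.
- by apply/not_open_cube; exists ord0; rewrite mxE unlift_none/= ?normrN aE /a; lra.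
- by apply/not_open_cube; exists ord0; rewrite mxE unlift_none/= ?normrN aE /a; lra.
move=> <-; rewrite [RHS]integral_mkcond; apply: eq_integral => t _.
rewrite patchE; case: ifPn => // /negP tN.
rewrite dfr//; apply/not_open_cube; exists ord0; rewrite mxE unlift_none/=.
rewrite leNgt; apply/negP => tr; apply: tN; rewrite inE/= in_itv/=.
by move: tr; rewrite ltr_norml => /andP[? ?]; apply/andP; rewrite /a; split; lra.
Qed.

Lemma integrable_cons n (f : 'rV[R]_n.+1 -> \bar R) :
  (leb R n.+1).-integrable setT f ->
  (leb_prod (leb R n)).-integrable setT (f \o @rV_cons R n).
Proof.
move=> /integrableP[mf fi]; apply/integrableP; split.
  by apply: measurableT_comp => //; exact: measurable_rV_cons.
apply: le_lt_trans fi.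
have := @ge0_integral_pushforward _ _ _ _ R _ (@measurable_rV_cons R n)
    (leb_prod (leb R n)) setT (abse \o f) measurableT.
rewrite preimage_setT => <- //; first exact: measurableT_comp.
by move=> y _; exact: abse_ge0.
Qed.

Lemma integral_leb_prod n (f : 'rV[R]_n.+1 -> \bar R) :
  (leb R n.+1).-integrable setT f ->
  (\int[leb R n.+1]_x f x = \int[leb_prod (leb R n)]_p f (rV_cons p))%E.
Proof.
move=> if_; have ifc := integrable_cons if_.
have := @integral_pushforward _ _ _ _ R _ (@measurable_rV_cons R n)
    (leb_prod (leb R n)) setT f.
rewrite preimage_setT => -> //.
exact: measurable_int _ if_.
Qed.

(** By Fubini, the derivative is integrated first along its own direction, where
the integral is the difference of two values outside the support. *)
Lemma integral_pderiv n (f : 'rV[R]_n -> R) j : C1c f ->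
  (\int[leb R n]_x (pderiv j f x)%:E = 0)%E.
Proof.
elim: n f j => [f [] //|n IH f j Cf].
have ip := Cc_integrable (C1c_pderiv j Cf).
rewrite (integral_leb_prod ip).
case: (unliftP ord0 j) => [i jE|jE].
  rewrite -integral12_prod_meas1; last exact: (integrable_cons ip).
  rewrite (eq_integral (fun=> 0%E)) ?integral0// => s _.
  rewrite /fubini_F jE -[RHS](IH (fun y => f (rV_cons (s, y))) i); last exact: C1c_cons1.
  by apply: eq_integral => y _; rewrite pderiv_cons1.
rewrite -integral21_prod_meas1; last exact: (integrable_cons ip).
rewrite (eq_integral (fun=> 0%E)) ?integral0// => y _.
by rewrite /fubini_G jE; exact: integral_pderiv_cons2.
Qed.

(** The one-dimensional case of [norm_le_integral_pderiv], restated with the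
measure [leb R 1], whose second factor is the Dirac mass on the point 'rV_0. *)
Lemma norm_le_integral_pderiv1 (f : 'rV[R]_1 -> R) y : C1c f ->
  (`|f y|%:E <= \int[leb R 1]_z `|pderiv ord0 f z|%:E)%E.
Proof.
move=> Cf; have mp := continuous_measurable_rV (C1c_pderiv ord0 Cf).1.
have mp' : measurable_fun setT (fun z : 'rV[R]_1 => `|pderiv ord0 f z|%:E).
  by do 2 apply: measurableT_comp => //.
rewrite integral_leb_cons_swap//=.
rewrite integral_dirac//; last first.
  exact: (measurable_integral_cons_swap mp').
rewrite diracT mul1e.
have -> : y = rV_cons (y ord0 ord0 : measurableTypeR R, 0).
  by apply/rowP => i; rewrite mxE (ord1 i) unlift_none.
exact: norm_le_integral_pderiv.
Qed.

(** At a point (s, y) of the plane, f^2 is bounded by a function A of y alone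
(integrating along the first coordinate) and by a function B of s alone, so
f^4 <= B(s) A(y) and the integral of the right-hand side factors. *)
Lemma integral_pow4_le_mul (f : 'rV[R]_2 -> R) : C1c f ->
  (\int[leb R 2]_x (f x ^+ 4)%:E <=
   (\int[leb R 2]_x `|pderiv ord0 (fun x => f x ^+ 2) x|%:E) *
   (\int[leb R 2]_x `|pderiv (lift ord0 ord0) (fun x => f x ^+ 2) x|%:E))%E.
Proof.
move=> Cf; have Cf2 := C1c_sqr Cf; set g := fun x => f x ^+ 2 in Cf2 *.
have md j : measurable_fun setT (fun x => `|pderiv j g x|%:E).
  do 2 apply: measurableT_comp => //.
  exact: continuous_measurable_rV (C1c_pderiv j Cf2).1.
have mf : measurable_fun setT (fun x => (f x ^+ 4)%:E).
  apply/measurable_EFinP; apply: measurable_funX.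
  exact: continuous_measurable_rV (C1c_Cc Cf).1.
pose A (y : 'rV[R]_1) := (\int[lebesgue_measure]_t
     `|pderiv ord0 g (rV_cons (t : measurableTypeR R, y))|%:E)%E.
pose B (s : measurableTypeR R) := (\int[leb R 1]_y
     `|pderiv (lift ord0 ord0) g (rV_cons (s, y))|%:E)%E.
have A0 y : (0 <= A y)%E by apply: integral_ge0 => t _; rewrite lee_fin.
have B0 s : (0 <= B s)%E by apply: integral_ge0 => t _; rewrite lee_fin.
have mA : measurable_fun setT A by exact: (measurable_integral_cons_swap (md _)).
have mB : measurable_fun setT B by exact: (measurable_integral_cons (md _)).
have fAB s y : ((f (rV_cons (s, y)) ^+ 4)%:E <= B s * A y)%E.
  have g0 : (0 <= (g (rV_cons (s, y)))%:E)%E by rewrite lee_fin sqr_ge0.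
  rewrite (_ : (_ ^+ 4)%:E = (g (rV_cons (s, y)))%:E * (g (rV_cons (s, y)))%:E)%E; last first.
    by rewrite -EFinM /g -exprD.
  have gE : g (rV_cons (s, y)) = `|g (rV_cons (s, y))| by rewrite ger0_norm// sqr_ge0.
  apply: lee_pmul => //; rewrite gE.
    have := norm_le_integral_pderiv1 y (C1c_cons1 s Cf2).
    by under eq_integral do rewrite pderiv_cons1.
  exact: norm_le_integral_pderiv.
rewrite integral_leb_cons//; last by move=> x; rewrite lee_fin (exprM _ 2 2) sqr_ge0.
apply: (@le_trans _ _ (\int[lebesgue_measure]_s \int[leb R 1]_y (B s * A y))%E).
  apply: ge0_le_integral => //.
  - by move=> s _; apply: integral_ge0 => y _; rewrite lee_fin (exprM _ 2 2) sqr_ge0.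
  - apply: (measurable_integral_cons mf).
    by move=> x; rewrite lee_fin (exprM _ 2 2) sqr_ge0.
  - under eq_fun do rewrite ge0_integralZl//.
    apply: emeasurable_funM => //.
  - move=> s _; apply: ge0_le_integral => //.
    + by move=> y _; rewrite lee_fin (exprM _ 2 2) sqr_ge0.
    + by apply: (measurableT_comp mf); exact: measurable_rV_cons1.
    + by apply: measurable_funeM.
under eq_integral do rewrite ge0_integralZl//.
rewrite ge0_integralZr//; last by apply: integral_ge0.
rewrite muleC; apply: lee_pmul.
- by apply: integral_ge0.
- by apply: integral_ge0.
- by rewrite integral_leb_cons_swap.
- by rewrite integral_leb_cons.
Qed.


Lemma sqint_Cc n (f : 'rV[R]_n -> R) : Cc f -> sqint (leb R n) setT f.
Proof.
move=> Cf; split; first exact: continuous_measurable_rV Cf.1.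
rewrite (_ : (fun x => _) = EFin \o (fun x => f x * f x)); last first.
  by apply/funext => x /=; rewrite expr2.
by apply: Cc_integrable; apply: CcM => //; case: Cf.
Qed.

Lemma sqr_integral_pderiv_sqr n (f : 'rV[R]_n -> R) j : C1c f ->
  (\int[leb R n]_x `|pderiv j (fun x => f x ^+ 2) x|) ^+ 2 <=
  4 * (\int[leb R n]_x (f x ^+ 2) * \int[leb R n]_x (pderiv j f x ^+ 2)).
Proof.
move=> Cf; have sf := sqint_Cc (C1c_Cc Cf); have sdf := sqint_Cc (C1c_pderiv j Cf).
have dE x : `|pderiv j (fun x => f x ^+ 2) x| = 2 * `|f x * pderiv j f x|.
  by rewrite pderiv_sqr ?normrM ?(ger0_norm (ler0n R 2))//; exact: C1c_derivable.
under eq_Rintegral do rewrite dE.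
rewrite RintegralZl//; last by apply: integrable_norm; exact: sqint_mul.
rewrite exprMn -natrX ler_pM2l//.
exact: cauchy_schwarz_norm.
Qed.

Lemma integral_pderiv_sqr_le n (f : 'rV[R]_n -> R) j : C1c f ->
  \int[leb R n]_x `|pderiv j (fun x => f x ^+ 2) x| <=
  \int[leb R n]_x (f x ^+ 2) + \int[leb R n]_x (pderiv j f x ^+ 2).
Proof.
move=> Cf; have sf := sqint_Cc (C1c_Cc Cf); have sdf := sqint_Cc (C1c_pderiv j Cf).
rewrite -RintegralD//; [|exact: sf.2|exact: sdf.2].
apply: le_Rintegral => //.
- by apply: integrable_norm; apply: Cc_integrable; exact: C1c_pderiv (C1c_sqr Cf).
- by apply: integrable_addr; [|exact: sf.2|exact: sdf.2].
move=> x _; rewrite pderiv_sqr; last exact: C1c_derivable.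
have := sqr_ge0 (f x + pderiv j f x); have := sqr_ge0 (f x - pderiv j f x).
by rewrite ler_norml => ? ?; apply/andP; split; lra.
Qed.

Lemma Cc_pow4 n (f : 'rV[R]_n -> R) : Cc f -> Cc (fun x => f x ^+ 4).
Proof.
move=> Cf; rewrite (_ : (fun x => _) = (fun x => f x * (f x * (f x * f x)))); last first.
  by apply/funext => x; rewrite !exprS expr0 mulr1.
by do 3 (apply: CcM; [exact: Cf.1|]).
Qed.

(** AM-GM on p q; in the application p and q are the integrals of
|d_j (phi^2)|, whose squares are bounded by Cauchy-Schwarz. *)
Lemma mul_le_of_sqr_le (p q S D0 D1 : R) : p ^+ 2 <= 4 * (S * D0) ->
  q ^+ 2 <= 4 * (S * D1) -> p * q <= 2 * (S * (D0 + D1)).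
Proof.
move=> Hp Hq; have : 0 <= (p - q) ^+ 2 by exact: sqr_ge0.
rewrite mulrDr sqrrB; lra.
Qed.

Lemma sum_ord2 (F : 'I_2 -> R) : \sum_j F j = F ord0 + F (lift ord0 ord0).
Proof. by rewrite !big_ord_recl big_ord0 addr0. Qed.

Lemma ladyzhenskaya2 (f : 'rV[R]_2 -> R) : C1c f ->
  \int[leb R 2]_x (f x ^+ 4) <=
  2 * (\int[leb R 2]_x (f x ^+ 2) * \sum_j \int[leb R 2]_x (pderiv j f x ^+ 2)).
Proof.
move=> Cf; have Cf2 := C1c_sqr Cf.
have := integral_pow4_le_mul Cf.
have ip j : (leb R 2).-integrable setT
    (EFin \o (fun x => `|pderiv j (fun x => f x ^+ 2) x|)).
  by apply: integrable_norm; apply: Cc_integrable; exact: C1c_pderiv.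
rewrite -!EFin_Rintegral//; last exact: (Cc_integrable (Cc_pow4 (C1c_Cc Cf))).
rewrite -EFinM lee_fin => /le_trans; apply.
rewrite sum_ord2; apply: mul_le_of_sqr_le; exact: sqr_integral_pderiv_sqr.
Qed.

(** On the slice at s, the hypothesis bounds the integral of f^4 by the integral
of f^2 times that of the tangential gradient; the former is at most
\int |d_0 (f^2)| whatever s is, hence comes out of the integral over s. *)
Lemma ladyzhenskaya_step n (f : 'rV[R]_n.+1 -> R) :
  (forall g : 'rV[R]_n -> R, C1c g ->
    \int[leb R n]_x (g x ^+ 4) <=
    2 * (\int[leb R n]_x (g x ^+ 2) * \sum_j \int[leb R n]_x (pderiv j g x ^+ 2))) ->
  C1c f ->
  \int[leb R n.+1]_x (f x ^+ 4) <=
  2 * (\int[leb R n.+1]_x `|pderiv ord0 (fun x => f x ^+ 2) x| *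
       \sum_j \int[leb R n.+1]_x (pderiv (lift ord0 j) f x ^+ 2)).
Proof.
move=> gn Cf; have Cf2 := C1c_sqr Cf.
have Cfs s : C1c (fun y => f (rV_cons (s, y))) by exact: C1c_cons1.
set m := \int[_]_x `| _ |.
have m0 : 0 <= m by exact: Rintegral_ge0.
have im : (leb R n.+1).-integrable setT
    (EFin \o (fun x => `|pderiv ord0 (fun x => f x ^+ 2) x|)).
  by apply: integrable_norm; apply: Cc_integrable; exact: C1c_pderiv.
have id j : (leb R n.+1).-integrable setT
    (EFin \o (fun x => pderiv (lift ord0 j) f x ^+ 2)).
  exact: (sqint_Cc (C1c_pderiv (lift ord0 j) Cf)).2.
have S_le s : \int[leb R n]_y (f (rV_cons (s, y)) ^+ 2) <= m.
  rewrite -lee_fin /m !EFin_Rintegral//; last exact: (sqint_Cc (C1c_Cc (Cfs s))).2.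
  rewrite [leRHS]integral_leb_cons_swap//; last exact: measurable_int _ im.
  apply: ge0_le_integral => //.
  - by move=> y _; rewrite lee_fin sqr_ge0.
  - exact: measurable_int _ (sqint_Cc (C1c_Cc (Cfs s))).2.
  - apply: (measurable_integral_cons_swap (f := fun x => `|pderiv ord0 _ x|%:E)) => //.
    exact: measurable_int _ im.
  - move=> y _; have := norm_le_integral_pderiv s y Cf2.
    by rewrite ger0_norm// sqr_ge0.
rewrite -lee_fin EFin_Rintegral//; last exact: (Cc_integrable (Cc_pow4 (C1c_Cc Cf))).
have mf4 := measurable_int _ (Cc_integrable (Cc_pow4 (C1c_Cc Cf))).
have f40 x : (0 <= (f x ^+ 4)%:E)%E by rewrite lee_fin (exprM _ 2 2) sqr_ge0.
rewrite integral_leb_cons//.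
have md j : measurable_fun setT (fun s : measurableTypeR R =>
    (\int[leb R n]_y (pderiv (lift ord0 j) f (rV_cons (s, y)) ^+ 2)%:E)%E).
  apply: (measurable_integral_cons (measurable_int _ (id j))).
  by move=> x; rewrite /= lee_fin sqr_ge0.
apply: (@le_trans _ _ (\int[lebesgue_measure]_s ((2 * m)%:E *
   \sum_j \int[leb R n]_y (pderiv (lift ord0 j) f (rV_cons (s, y)) ^+ 2)%:E))%E).
  apply: ge0_le_integral => //.
  - by move=> s _; exact: integral_ge0.
  - exact: (measurable_integral_cons mf4).
  - by apply: measurable_funeM; apply: emeasurable_sum => j; exact: md.
  move=> s _; have := gn _ (Cfs s).
  rewrite -lee_fin EFin_Rintegral//; last exact: (Cc_integrable (Cc_pow4 (C1c_Cc (Cfs s)))).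
  move=> /le_trans; apply.
  have -> : (\sum_j \int[leb R n]_y (pderiv (lift ord0 j) f (rV_cons (s, y)) ^+ 2)%:E =
     (\sum_j \int[leb R n]_y (pderiv j (fun y => f (rV_cons (s, y))) y ^+ 2))%R%:E)%E.
    rewrite -sumEFin; apply: eq_bigr => j _.
    rewrite EFin_Rintegral; [|exact: measurableT|exact: (sqint_Cc (C1c_pderiv j (Cfs s))).2].
    by apply: eq_integral => y _; rewrite pderiv_cons1.
  rewrite -EFinM lee_fin mulrA ler_wpM2r//.
    by apply: sumr_ge0 => j _; apply: Rintegral_ge0 => y _; exact: sqr_ge0.
  by rewrite ler_pM2l.
rewrite ge0_integralZl//; last 3 first.
- by apply: emeasurable_sum => j; exact: md.
- by move=> s _; apply: sume_ge0 => j _; apply: integral_ge0 => y _; rewrite lee_fin sqr_ge0.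
- by rewrite lee_fin mulr_ge0.
rewrite [in leRHS]mulrA [leRHS]EFinM; apply: lee_pmul => //.
- by rewrite lee_fin mulr_ge0.
- apply: integral_ge0 => s _.
  by apply: sume_ge0 => j _; apply: integral_ge0 => y _; rewrite lee_fin sqr_ge0.
rewrite ge0_integral_sum//; last first.
  by move=> j s _; apply: integral_ge0 => y _; rewrite lee_fin sqr_ge0.
rewrite -sumEFin; apply: lee_sum => j _.
rewrite EFin_Rintegral// integral_leb_cons//; first exact: measurable_int _ (id j).
by move=> x; rewrite lee_fin sqr_ge0.
Qed.

Lemma mul_le_sqrD (S D : R) : 0 <= S -> 0 <= D -> S * D <= (S + D) ^+ 2.
Proof. by move=> S0 D0; rewrite sqrrD; nra. Qed.

Lemma mul_le_sqr_sum3 (m S D0 D : R) : 0 <= S -> 0 <= D0 -> 0 <= D -> m <= S + D0 ->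
  m * D <= (S + (D0 + D)) ^+ 2.
Proof.
move=> S0 D00 D_0 mS; apply: (@le_trans _ _ ((S + D0) * D)); first by rewrite ler_wpM2r.
by rewrite addrA mul_le_sqrD// addr_ge0.
Qed.

Lemma ladyzhenskaya23 n (f : 'rV[R]_n -> R) : n = 2%N \/ n = 3%N -> C1c f ->
  \int[leb R n]_x (f x ^+ 4) <=
  2 * (\int[leb R n]_x (f x ^+ 2) + \sum_j \int[leb R n]_x (pderiv j f x ^+ 2)) ^+ 2.
Proof.
have S0 k (g : 'rV[R]_k -> R) : 0 <= \int[leb R k]_x (g x ^+ 2).
  by apply: Rintegral_ge0 => x _; exact: sqr_ge0.
case=> nE; subst n => Cf.
  apply: (le_trans (ladyzhenskaya2 Cf)).
  rewrite ler_pM2l//; apply: mul_le_sqrD; first exact: S0.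
  by apply: sumr_ge0 => j _; exact: S0.
apply: (le_trans (ladyzhenskaya_step ladyzhenskaya2 Cf)).
rewrite ler_pM2l// [in leRHS]big_ord_recl.
apply: (mul_le_sqr_sum3 _ _ _ (integral_pderiv_sqr_le ord0 Cf)).
- exact: S0.
- exact: S0.
- by apply: sumr_ge0 => j _; exact: S0.
Qed.

End ladyzhenskaya.

(** * Test functions of an open set *)

Section test_functions.
Context (R : realType) (d : nat).
Implicit Types (phi psi : 'rV[R]_d -> R) (Omega : set 'rV[R]_d).

Lemma CkS k phi : Ck k.+1 phi -> Ck k phi.
Proof.
elim: k phi => [|k IH] phi [cp dp]; first by split.
by split=> // j; have [dj /IH] := dp j.
Qed.

Lemma CkD k phi psi : Ck k phi -> Ck k psi -> Ck k (fun x => phi x + psi x).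
Proof.
elim: k phi psi => [|k IH] phi psi [cf df] [cg dg].
  by split => // x; exact: (cvgD (cf x) (cg x)).
split; first by move=> x; exact: (cvgD (cf x) (cg x)).
move=> j; have [dfj /IH Cf] := df j; have [dgj /Cf] := dg j.
rewrite (_ : (fun x => pderiv j phi x + _) = pderiv j (fun x => phi x + psi x)); last first.
  by apply/funext => x; rewrite /pderiv -deriveD.
by move=> Cfg; split; [move=> x; exact: derivableD|exact: Cfg].
Qed.

Lemma CkM k phi psi : Ck k phi -> Ck k psi -> Ck k (fun x => phi x * psi x).
Proof.
elim: k phi psi => [|k IH] phi psi Cf Cg.
  by split => // x; exact: (cvgM (Cf.1 x) (Cg.1 x)).
have [cf df] := Cf; have [cg dg] := Cg.
split; first by move=> x; exact: (cvgM (cf x) (cg x)).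
move=> j; have [dfj Cfj] := df j; have [dgj Cgj] := dg j.
have := CkD (IH _ _ (CkS Cf) Cgj) (IH _ _ (CkS Cg) Cfj).
rewrite (_ : (fun x => phi x * pderiv j psi x + _) = pderiv j (fun x => phi x * psi x)); last first.
  apply/funext => x; rewrite /pderiv [RHS](_ : _ = 'D_(delta_mx ord0 j) (phi * psi) x)//.
  by rewrite deriveM.
by move=> Cfg; split; [move=> x; exact: derivableM|exact: Cfg].
Qed.

Lemma Ck_cst k (a : R) : Ck k (fun _ : 'rV[R]_d => a).
Proof.
elim: k a => [|k IH] a; first by split; [exact: cst_continuous|].
split; first exact: cst_continuous.
move=> j; split=> [x|]; first exact: derivable_cst.
rewrite (_ : pderiv j _ = fun=> 0)//; apply/funext => x.
exact: derive_cst.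
Qed.

Lemma test_fun_derivable Omega phi j x : test_fun Omega phi ->
  derivable phi x (delta_mx ord0 j).
Proof. by move=> [sp _]; have [_ /(_ j)[dj _]] := sp 1%N; exact: dj. Qed.

Lemma test_fun_sqr Omega phi : test_fun Omega phi -> test_fun Omega (fun x => phi x ^+ 2).
Proof.
move=> [sp [K [cK KO K0]]]; split; last first.
  by exists K; split => // x /K0 ->; rewrite expr0n/=.
move=> k; rewrite (_ : (fun x => _) = fun x => phi x * phi x); first exact: CkM.
by apply/funext => x; rewrite expr2.
Qed.

Lemma test_funB Omega phi psi : test_fun Omega phi -> test_fun Omega psi ->
  test_fun Omega (fun x => phi x - psi x).
Proof.
move=> [sp [K [cK KO K0]]] [sp' [K' [cK' KO' K0']]]; split; last first.
  exists (K `|` K'); split.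
  - exact: compactU.
  - by move=> x [/KO|/KO'].
  - by move=> x /not_orP[/K0 -> /K0' ->]; rewrite subrr.
move=> k; rewrite (_ : (fun x => _) = fun x => phi x + (-1) * psi x).
  by apply: CkD => //; apply: CkM => //; exact: Ck_cst.
by apply/funext => x; rewrite mulN1r.
Qed.

Lemma pderivB phi psi j x : derivable phi x (delta_mx ord0 j) ->
  derivable psi x (delta_mx ord0 j) ->
  pderiv j (fun x => phi x - psi x) x = pderiv j phi x - pderiv j psi x.
Proof. by move=> dp dq; rewrite /pderiv -deriveB. Qed.

Lemma test_fun_C1c Omega phi : test_fun Omega phi -> C1c phi.
Proof.
move=> [sp [K [cK KO K0]]]; split; first exact: sp.
have [M [Mr HM]] := compact_bounded cK.
exists (`|M| + 1); first by rewrite addr_ge0.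
move=> x /not_open_cube[i Hi]; apply: K0 => Kx.
have M1 : M < `|M| + 2^-1 by rewrite (le_lt_trans (ler_norm M))// ltrDl invr_gt0.
have := HM _ M1 x Kx => /= xM.
have xi : `|x ord0 i| <= `|x|.
  rewrite [leRHS]/Num.norm /= mx_normrE; apply/bigmax_geP; right => /=.
  by exists (ord0, i).
lra.
Qed.

(** Outside Omega a test function vanishes in a neighbourhood of the point,
because the complement of its compact support is open. *)
Lemma test_fun_out Omega phi x : test_fun Omega phi -> ~ Omega x ->
  phi x = 0 /\ forall j, pderiv j phi x = 0.
Proof.
move=> [sp [K [cK KO K0]]] Ox; have Kx : ~ K x by move=> /KO.
split; first exact: K0.
move=> j; have f0 : \forall y \near x, phi y = cst 0 y.
  have oK : open (~` K).
    exact: (closed_openC (compact_closed (@norm_hausdorff R 'rV[R]_d) cK)).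
  have : nbhs x (~` K) by exact: open_nbhs_nbhs.
  by apply: filterS => y /K0.
by rewrite /pderiv (near_eq_derive _ f0) derive_cst.
Qed.

End test_functions.

Section integrals_on_open_sets.
Context (R : realType) (d : nat) (Omega : set 'rV[R]_d).
Hypothesis mO : measurable Omega.

Lemma Rintegral_vanish_out (f : 'rV[R]_d -> R) : (forall x, ~ Omega x -> f x = 0) ->
  \int[leb R d]_(x in Omega) f x = \int[leb R d]_x f x.
Proof.
move=> f0; rewrite Rintegral_mkcond; apply: eq_Rintegral => x _.
by rewrite patchE; case: ifPn => // /negP xO; rewrite f0// => Ox; apply: xO; rewrite inE.
Qed.

Lemma sqint_sub (f : 'rV[R]_d -> R) :
  sqint (leb R d) setT f -> sqint (leb R d) Omega f.
Proof.
move=> [mf f2]; split; first exact: measurable_funTS.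
exact: (integrableS measurableT mO (@subsetT _ _) f2).
Qed.

Lemma test_fun_sqint phi : test_fun Omega phi -> sqint (leb R d) Omega phi.
Proof. by move=> /test_fun_C1c/C1c_Cc/sqint_Cc/sqint_sub. Qed.

Lemma test_fun_pderiv_sqint phi j : test_fun Omega phi ->
  sqint (leb R d) Omega (pderiv j phi).
Proof. by move=> /test_fun_C1c/(C1c_pderiv j)/sqint_Cc/sqint_sub. Qed.

Lemma test_fun_pow4_le phi : d = 2%N \/ d = 3%N -> test_fun Omega phi ->
  \int[leb R d]_(x in Omega) (phi x ^+ 4) <=
  2 * (\int[leb R d]_(x in Omega) (phi x ^+ 2) +
       \sum_j \int[leb R d]_(x in Omega) (pderiv j phi x ^+ 2)) ^+ 2.
Proof.
move=> hd tp; have out := test_fun_out tp.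
rewrite !Rintegral_vanish_out; last 2 first.
- by move=> x /out[-> _]; rewrite expr0n/=.
- by move=> x /out[-> _]; rewrite expr0n/=.
under [X in _ + X]eq_bigr => j _.
  rewrite Rintegral_vanish_out; last by move=> x /out[_ ->]; rewrite expr0n/=.
  over.
by apply: ladyzhenskaya23 => //; exact: test_fun_C1c tp.
Qed.

Lemma integral_pderiv_test_fun phi j : test_fun Omega phi ->
  \int[leb R d]_(x in Omega) (pderiv j phi x) = 0.
Proof.
move=> tp; rewrite Rintegral_vanish_out; last by move=> x /(test_fun_out tp)[_ ->].
by rewrite /Rintegral integral_pderiv//; exact: test_fun_C1c tp.
Qed.

End integrals_on_open_sets.

(** * Fourth powers: truncation and a trilinear estimate *)

(** Lets estimates with an error of order s be used as limits without
constructing sequences. *)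
Lemma le_of_le_small (R : realFieldType) (x y C : R) :
  (forall s, 0 < s -> s <= 1 -> x <= y + s * C) -> x <= y.
Proof.
move=> H; rewrite leNgt; apply/negP => yx.
have C1 : 0 < `|C| + 1 by rewrite ltr_wpDl.
have D0 : 0 < (x - y) / 2 by lra.
pose s := Num.min 1 ((x - y) / 2 / (`|C| + 1)).
have s0 : 0 < s by rewrite lt_min ltr01 divr_gt0.
have s1 : s <= 1 by rewrite ge_min lexx.
have sC : s * C <= (x - y) / 2.
  apply: (@le_trans _ _ (s * (`|C| + 1))).
    by rewrite ler_pM2l// (le_trans (ler_norm C))// lerDl.
  by rewrite -ler_pdivlMr// ge_min lexx orbT.
have := H s s0 s1; lra.
Qed.

Section fourth_powers.
Context d (T : measurableType d) (R : realType).
Context (mu : {measure set T -> \bar R}) (D : set T).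
Hypothesis mD : measurable D.
Implicit Types f g u w phi : T -> R.
Local Notation sqint := (sqint mu D).

Lemma sqint_trunc f (M : R) : 0 <= M -> sqint f ->
  sqint (fun x => Num.min (f x ^+ 2) M).
Proof.
move=> M0 [mf f2].
have mt : measurable_fun D (fun x => Num.min (f x ^+ 2) M).
  by apply: measurable_minr => //; exact: measurable_funX.
split => //; apply: (le_integrable_real mD (g := fun x => M * f x ^+ 2)).
- exact: measurable_funX.
- move=> x _; have := sqr_ge0 (f x); set a := f x ^+ 2 => a0.
  rewrite ger0_norm ?sqr_ge0// expr2; apply: ler_pM.
  + by rewrite le_min a0.
  + by rewrite le_min a0.
  + by rewrite ge_min lexx orbT.
  + by rewrite ge_min lexx.
- exact: integrable_scale.
Qed.

(** Monotone convergence: the truncations of f^2 at level n increase to f^2.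
This is how integrability of f^4 is obtained, as it is not known beforehand. *)
Lemma sqint_sqr_of_trunc f (C : R) : sqint f ->
  (forall n : nat, \int[mu]_(x in D) (Num.min (f x ^+ 2) n%:R ^+ 2) <= C) ->
  sqint (fun x => f x ^+ 2) /\ \int[mu]_(x in D) ((f x ^+ 2) ^+ 2) <= C.
Proof.
move=> sf H; have [mf _] := sf.
pose F n x := (Num.min (f x ^+ 2) n%:R ^+ 2)%:E.
have mF n : measurable_fun D (F n) by exact: measurable_int _ (sqint_trunc _ sf).2.
have F0 n x : D x -> (0 <= F n x)%E by rewrite lee_fin sqr_ge0.
have ndF x : D x -> {homo F^~ x : n m / (n <= m)%N >-> (n <= m)%E}.
  move=> _ n m nm; rewrite lee_fin lerXn2r ?nnegrE ?le_min ?sqr_ge0 ?ler0n//.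
  by rewrite ge_min lexx/= ge_min ler_nat nm orbT.
have limF x : limn (F^~ x) = ((f x ^+ 2) ^+ 2)%:E.
  apply/cvg_lim => //; apply: cvg_near_cst.
  near=> n; rewrite /F min_l//.
  near: n; exact: nbhs_infty_ger.
have le_C : (\int[mu]_(x in D) ((f x ^+ 2) ^+ 2)%:E <= C%:E)%E.
  under eq_integral do rewrite -limF.
  rewrite monotone_convergence//; apply: lime_le.
    apply: ereal_nondecreasing_is_cvgn => n m nm.
    apply: ge0_le_integral => //; [by move=> x; exact: F0| by move=> x Dx; exact: ndF].
  apply: nearW => n; rewrite /F -EFin_Rintegral ?lee_fin//.
  exact: (sqint_trunc _ sf).2.
have i4 : mu.-integrable D (fun x => ((f x ^+ 2) ^+ 2)%:E).
  apply/integrableP; split.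
    by apply/measurable_EFinP; do 2 apply: measurable_funX.
  under eq_integral do rewrite gee0_abs ?lee_fin ?sqr_ge0//.
  by rewrite (le_lt_trans le_C)// ltry.
split; first by split => //; exact: measurable_funX.
by rewrite -lee_fin EFin_Rintegral.
Unshelve. all: by end_near. Qed.

(** Truncated fourth powers are continuous in L^2: with m the truncation of w^2
and c = phi^2, m^2 - c^2 <= 2 M (w^2 - phi^2) when m > c, and
w^2 - phi^2 is small in L^1 by Young's inequality with parameter s. *)
Lemma integral_trunc_le w phi (M s : R) : 0 <= M -> 0 < s ->
  sqint w -> sqint phi -> sqint (fun x => phi x ^+ 2) ->
  \int[mu]_(x in D) (Num.min (w x ^+ 2) M ^+ 2) <=
  \int[mu]_(x in D) ((phi x ^+ 2) ^+ 2) +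
  2 * M * (\int[mu]_(x in D) ((w x - phi x) ^+ 2) + (s * \int[mu]_(x in D) (w x ^+ 2)
     + s^-1 * \int[mu]_(x in D) ((w x - phi x) ^+ 2))).
Proof.
move=> M0 s0 sw sp sp2.
have swp : sqint (fun x => w x - phi x) by exact: sqintB.
have i1 : mu.-integrable D (EFin \o (fun x => w x ^+ 2)) by exact: sw.2.
have i2 : mu.-integrable D (EFin \o (fun x => (w x - phi x) ^+ 2)) by exact: swp.2.
have i3 : mu.-integrable D (EFin \o (fun x => (phi x ^+ 2) ^+ 2)) by exact: sp2.2.
have i4 := integrable_scale mD s i1.
have i5 := integrable_scale mD s^-1 i2.
have i6 := integrable_addr mD i4 i5.
have i7 := integrable_addr mD i2 i6.
have i8 := integrable_scale mD (2 * M) i7.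
rewrite -(RintegralZl _ mD i1) -(RintegralZl _ mD i2) -(RintegralD mD i4 i5).
rewrite -(RintegralD mD i2 i6) -(RintegralZl _ mD i7) -(RintegralD mD i3 i8).
apply: le_Rintegral => //.
- exact: (sqint_trunc M0 sw).2.
- exact: integrable_addr.
move=> x _; set a := w x; set c := phi x.
have Hs : 2 * `|a * (a - c)| <= s * a ^+ 2 + s^-1 * (a - c) ^+ 2.
  have := sqr_ge0 (s * `|a| - `|a - c|).
  rewrite sqrrB exprMn !real_normK ?num_real// normrM => H.
  rewrite -(ler_pM2l s0) mulrDr (mulrA s s^-1) mulfV ?gt_eqF// mul1r; lra.
have ac : a ^+ 2 - c ^+ 2 <= (a - c) ^+ 2 + (s * a ^+ 2 + s^-1 * (a - c) ^+ 2).
  have := ler_norm (a * (a - c)); have := sqr_ge0 (a - c).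
  move: Hs; set X := s * _ + _ => Hs H1 H2.
  have -> : a ^+ 2 - c ^+ 2 = 2 * (a * (a - c)) - (a - c) ^+ 2 by ring.
  lra.
move: ac; set Y := (_ + (_ + _)) => ac.
have Y0 : 0 <= Y.
  by apply: addr_ge0; [|apply: addr_ge0; apply: mulr_ge0]; rewrite ?sqr_ge0// ?invr_ge0 ltW.
have c0 := sqr_ge0 c; have a0 := sqr_ge0 a.
set m := Num.min _ _.
have m0 : 0 <= m by rewrite le_min a0 M0.
have mM : m <= M by rewrite ge_min lexx orbT.
have ma : m <= a ^+ 2 by rewrite ge_min lexx.
have [mc|cm] := leP m (c ^+ 2).
  by rewrite ler_wpDr ?mulr_ge0// lerXn2r// nnegrE.
rewrite -lerBlDl (_ : m ^+ 2 - _ = (m + c ^+ 2) * (m - c ^+ 2)); last by ring.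
by apply: ler_pM; lra.
Qed.

Lemma sqint_mul_sqr u w : measurable_fun D u -> measurable_fun D w ->
  sqint (fun x => u x ^+ 2) -> sqint (fun x => w x ^+ 2) ->
  sqint (fun x => u x * w x).
Proof.
move=> mu_ mw su sw; split; first exact: measurable_funM.
rewrite (_ : (fun x => _) = EFin \o (fun x => u x ^+ 2 * w x ^+ 2)).
  exact: sqint_mul.
by apply/funext => x /=; rewrite exprMn.
Qed.

(** Stability of the integral of u w g in the L^4 x L^4 x L^2 topology. Writing
u w g - u phi a = u w (g - a) + u (w - phi) a, each product is split by
Young's inequality with parameter s, which gives a bound linear in s without
extracting roots. *)
Lemma trilinear_close u g w a phi (s : R) : 0 < s -> s <= 1 ->
  measurable_fun D u -> measurable_fun D w -> measurable_fun D phi ->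
  sqint g -> sqint a ->
  sqint (fun x => u x ^+ 2) -> sqint (fun x => w x ^+ 2) -> sqint (fun x => phi x ^+ 2) ->
  sqint (fun x => (w x - phi x) ^+ 2) ->
  \int[mu]_(x in D) ((g x - a x) ^+ 2) <= s ^+ 2 ->
  \int[mu]_(x in D) (((w x - phi x) ^+ 2) ^+ 2) <= 8 * s ^+ 4 ->
  `|\int[mu]_(x in D) (u x * w x * g x) - \int[mu]_(x in D) (u x * phi x * a x)| <=
  s * (\int[mu]_(x in D) ((u x * w x) ^+ 2) + 2 * \int[mu]_(x in D) (g x ^+ 2) + 2
       + \int[mu]_(x in D) ((u x ^+ 2) ^+ 2) + 9).
Proof.
move=> s0 s1 mu_ mw mphi sg sa su2 sw2 sp2 swp2 Hga Hwp.
have suw := sqint_mul_sqr mu_ mw su2 sw2.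
have sup := sqint_mul_sqr mu_ mphi su2 sp2.
have sga := sqintB mD sg sa.
have suwp : sqint (fun x => u x * (w x - phi x)).
  by apply: sqint_mul_sqr => //; exact: measurable_funB.
rewrite -(RintegralB mD (sqint_mul mD suw sg) (sqint_mul mD sup sa)).
have j1 : mu.-integrable D (EFin \o (fun x => (u x * w x) ^+ 2)) by exact: suw.2.
have j2 : mu.-integrable D (EFin \o (fun x => g x ^+ 2)) by exact: sg.2.
have j3 : mu.-integrable D (EFin \o (fun x => (g x - a x) ^+ 2)) by exact: sga.2.
have j4 : mu.-integrable D (EFin \o (fun x => (u x ^+ 2) ^+ 2)) by exact: su2.2.
have j5 : mu.-integrable D (EFin \o (fun x => ((w x - phi x) ^+ 2) ^+ 2)) by exact: swp2.2.
have k1 := integrable_scale mD s j1.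
have k2 := integrable_scale mD (2 * s) j2.
have k3 := integrable_scale mD (s^-1 + 2 * s) j3.
have k4 := integrable_scale mD s j4.
have k5 := integrable_scale mD (s^-1 ^+ 3) j5.
have l4 := integrable_addr mD k4 k5.
have l3 := integrable_addr mD k3 l4.
have l2 := integrable_addr mD k2 l3.
have l1 := integrable_addr mD k1 l2.
apply: (@le_trans _ _ (\int[mu]_(x in D)
  (s * (u x * w x) ^+ 2 + (2 * s * g x ^+ 2 + ((s^-1 + 2 * s) * (g x - a x) ^+ 2 +
    (s * (u x ^+ 2) ^+ 2 + s^-1 ^+ 3 * ((w x - phi x) ^+ 2) ^+ 2)))))).
  apply: normr_Rintegral_le => //.
    apply: measurable_funB; apply: measurable_funM.
    - exact: measurable_funM.
    - by case: sg.
    - exact: measurable_funM.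
    - by case: sa.
  move=> x _.
  set U := u x; set W := w x; set G := g x; set A := a x; set P := phi x.
  have E : U * W * G - U * P * A = (U * W) * (G - A) + (U * (W - P)) * A by ring.
  rewrite E.
  have sV : s * s^-1 = 1 by rewrite mulfV// gt_eqF.
  set t := s^-1 in sV *.
  have t0 : 0 < t by rewrite invr_gt0.
  (* Young's inequality with weight s, up to a factor 2 *)
  have B1 (p q : R) : `|p * q| <= s * p ^+ 2 + t * q ^+ 2.
    have := sqr_ge0 (s * `|p| - `|q|); have := sqr_ge0 p; have := sqr_ge0 q.
    rewrite sqrrB exprMn !real_normK ?num_real// normrM => H1 H2 H.
    rewrite -(ler_pM2l s0) mulrDr (mulrA s t) sV mul1r.
    have : 0 <= s * (`|p| * `|q|) by rewrite !mulr_ge0// ltW.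
    lra.
  have H1 := B1 (U * W) (G - A).
  have H2 : `|U * (W - P) * A| <= s * A ^+ 2 + t * (U * (W - P)) ^+ 2.
    by rewrite mulrC; exact: B1.
  have H3 : A ^+ 2 <= 2 * G ^+ 2 + 2 * (G - A) ^+ 2.
    by have := sqr_ge0 (2 * G - A); rewrite !sqrrB exprMn; lra.
  have H4 : t * (U * (W - P)) ^+ 2 <= s * (U ^+ 2) ^+ 2 + t ^+ 3 * ((W - P) ^+ 2) ^+ 2.
    rewrite (_ : t * _ = U ^+ 2 * (t * (W - P) ^+ 2)); last by ring.
    apply: (le_trans (ler_norm _)); apply: (le_trans (B1 _ _)).
    by rewrite (_ : t * _ = t ^+ 3 * ((W - P) ^+ 2) ^+ 2)//; ring.
  have H5 : s * A ^+ 2 <= s * (2 * G ^+ 2 + 2 * (G - A) ^+ 2) by rewrite ler_pM2l.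
  have := ler_normD (U * W * (G - A)) (U * (W - P) * A).
  lra.
rewrite (RintegralD mD k1 l2) (RintegralD mD k2 l3) (RintegralD mD k3 l4) (RintegralD mD k4 k5).
rewrite (RintegralZl _ mD j1) (RintegralZl _ mD j2) (RintegralZl _ mD j3).
rewrite (RintegralZl _ mD j4) (RintegralZl _ mD j5).
set I1 := Rintegral _ _ _; set I2 := Rintegral _ _ _.
move: Hga Hwp; set I3 := Rintegral _ _ _; set I5 := Rintegral _ _ _ => Hga Hwp.
set I4 := Rintegral _ _ _.
have sV : s * s^-1 = 1 by rewrite mulfV// gt_eqF.
have t0 : 0 < s^-1 by rewrite invr_gt0.
have H3 : (s^-1 + 2 * s) * I3 <= s + 2 * s.
  apply: (@le_trans _ _ ((s^-1 + 2 * s) * s ^+ 2)).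
    by rewrite ler_wpM2l// addr_ge0// ?mulr_ge0// ltW.
  rewrite (_ : _ * s ^+ 2 = (s * s^-1) * s + 2 * s * (s * s)); last by ring.
  rewrite sV mul1r lerD2l -[leRHS]mulr1 ler_pM2l ?mulr_gt0//.
  by rewrite mulr_ile1// ltW.
have H5 : s^-1 ^+ 3 * I5 <= 8 * s.
  apply: (@le_trans _ _ (s^-1 ^+ 3 * (8 * s ^+ 4))).
    by rewrite ler_pM2l// exprn_gt0.
  rewrite [leLHS](_ : _ = 8 * s * (s * s^-1) ^+ 3); last by move: s^-1 => t; ring.
  by rewrite sV expr1n mulr1.
lra.
Qed.

End fourth_powers.

(** * The spaces L^2, H^1, X and V *)

Section matrix_L2.
Context (R : realType) (d : nat) (Omega : set 'rV[R]_d).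
Hypothesis mO : measurable Omega.
Context (m n : nat).
Implicit Types F G : 'rV[R]_d -> 'M[R]_(m, n).
Local Notation sqint := (sqint (leb R d) Omega).

Lemma L2D F G : L2 Omega F -> L2 Omega G -> L2 Omega (F + G).
Proof.
move=> LF LG i j; have := sqintD mO (LF i j) (LG i j).
by rewrite (_ : (fun x => _ + _) = fun x => (F + G) x i j)//; apply/funext => x; rewrite mxE.
Qed.

Lemma L2Z a F : L2 Omega F -> L2 Omega (a *: F).
Proof.
move=> LF i j; have := sqintZ mO a (LF i j).
by rewrite (_ : (fun x => _ * _) = fun x => (a *: F) x i j)//; apply/funext => x; rewrite mxE.
Qed.

Lemma L2N F : L2 Omega F -> L2 Omega (- F).
Proof. by move=> LF; rewrite -scaleN1r; exact: L2Z. Qed.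

Lemma L2B F G : L2 Omega F -> L2 Omega G -> L2 Omega (F - G).
Proof. by move=> LF LG; rewrite -scaleN1r; apply: L2D => //; exact: L2Z. Qed.

Lemma ipE F G : L2 Omega F -> L2 Omega G ->
  ip Omega F G = \sum_i \sum_j \int[leb R d]_(x in Omega) (F x i j * G x i j).
Proof.
move=> LF LG; rewrite /ip Rintegral_sum//.
  apply: eq_bigr => i _; rewrite Rintegral_sum// => j.
  exact: (sqint_mul mO (LF i j) (LG i j)).
move=> i; apply: integrable_bigsum => // j.
exact: (sqint_mul mO (LF i j) (LG i j)).
Qed.

Lemma ip_ge0 F : 0 <= ip Omega F F.
Proof.
apply: Rintegral_ge0 => x _; apply: sumr_ge0 => i _; apply: sumr_ge0 => j _.
by rewrite -expr2 sqr_ge0.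
Qed.

Lemma norm2_sqr F : norm2 Omega F ^+ 2 = ip Omega F F.
Proof. by rewrite sqr_sqrtr// ip_ge0. Qed.

Lemma norm2_ge0 F : 0 <= norm2 Omega F.
Proof. exact: sqrtr_ge0. Qed.

Lemma norm2_sqrE F : L2 Omega F ->
  norm2 Omega F ^+ 2 = \sum_i \sum_j \int[leb R d]_(x in Omega) (F x i j ^+ 2).
Proof.
by move=> LF; rewrite norm2_sqr ipE.
Qed.

Lemma ipDl F G K : L2 Omega F -> L2 Omega G -> L2 Omega K ->
  ip Omega (F + G) K = ip Omega F K + ip Omega G K.
Proof.
move=> LF LG LK; rewrite !ipE//; last exact: L2D.
rewrite -big_split; apply: eq_bigr => i _; rewrite -big_split; apply: eq_bigr => j _ /=.
rewrite -RintegralD//; [|exact: (sqint_mul mO (LF i j) (LK i j))|exact: (sqint_mul mO (LG i j) (LK i j))].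
by apply: eq_Rintegral => x _; rewrite mxE mulrDl.
Qed.

Lemma ipZl a F G : L2 Omega F -> L2 Omega G ->
  ip Omega (a *: F) G = a * ip Omega F G.
Proof.
move=> LF LG; rewrite !ipE//; last exact: L2Z.
rewrite big_distrr; apply: eq_bigr => i _; rewrite big_distrr; apply: eq_bigr => j _ /=.
rewrite -RintegralZl//; last exact: (sqint_mul mO (LF i j) (LG i j)).
by apply: eq_Rintegral => x _; rewrite mxE mulrA.
Qed.

Lemma ipC F G : ip Omega F G = ip Omega G F.
Proof.
apply: eq_Rintegral => x _; apply: eq_bigr => i _; apply: eq_bigr => j _.
by rewrite mulrC.
Qed.

Lemma ipBl F G K : L2 Omega F -> L2 Omega G -> L2 Omega K ->
  ip Omega (F - G) K = ip Omega F K - ip Omega G K.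
Proof.
move=> LF LG LK; rewrite -scaleN1r ipDl ?ipZl ?mulN1r//; exact: L2Z.
Qed.

Lemma ip_le_norm2 F G : L2 Omega F -> L2 Omega G ->
  `|ip Omega F G| <= norm2 Omega F * norm2 Omega G.
Proof.
move=> LF LG.
have : ip Omega F G ^+ 2 <= ip Omega F F * ip Omega G G.
  apply: discriminant_le => [|t]; first exact: ip_ge0.
  have LZ := L2Z t LG.
  have := ip_ge0 (F + t *: G).
  rewrite ipDl//; last exact: L2D.
  rewrite (ipC F) (ipC (t *: G)) !ipDl// (ipZl t LG LF) (ipC F (_ *: _)) (ipZl t LG LF).
  rewrite (ipZl t LG LZ) (ipC G (_ *: _)) (ipZl t LG LG) (ipC G F).
  by set a := ip _ _ _; set b := ip _ _ _; set c := ip _ _ _; lra.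
rewrite -!norm2_sqr -exprMn -[X in X <= _]real_normK ?num_real//.
by rewrite ler_pXn2r// nnegrE// mulr_ge0// norm2_ge0.
Qed.

Lemma norm2D F G : L2 Omega F -> L2 Omega G ->
  norm2 Omega (F + G) <= norm2 Omega F + norm2 Omega G.
Proof.
move=> LF LG; have LFG := L2D LF LG.
rewrite -(@ler_pXn2r _ 2)// ?nnegrE ?addr_ge0 ?norm2_ge0//.
rewrite norm2_sqr ipDl// (ipC F) (ipC G) !ipDl// sqrrD !norm2_sqr (ipC G F).
have := le_trans (ler_norm _) (ip_le_norm2 LF LG); lra.
Qed.

Lemma norm2_sqrB_le F G : L2 Omega F -> L2 Omega G ->
  norm2 Omega (F - G) ^+ 2 <= 2 * norm2 Omega F ^+ 2 + 2 * norm2 Omega G ^+ 2.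
Proof.
move=> LF LG; rewrite !norm2_sqr.
have E : ip Omega (F - G) (F - G) + ip Omega (F + G) (F + G) =
    2 * ip Omega F F + 2 * ip Omega G G.
  rewrite (ipDl LF LG (L2D LF LG)) (ipBl LF LG (L2B LF LG)).
  rewrite (ipC F (F + G)) (ipC G (F + G)) (ipC F (F - G)) (ipC G (F - G)).
  rewrite (ipDl LF LG LF) (ipDl LF LG LG) (ipBl LF LG LF) (ipBl LF LG LG) (ipC F G).
  by ring.
by rewrite -E lerDl ip_ge0.
Qed.

Lemma norm2N F : norm2 Omega (- F) = norm2 Omega F.
Proof.
congr Num.sqrt; apply: eq_Rintegral => x _.
by apply: eq_bigr => i _; apply: eq_bigr => j _; rewrite !mxE mulrNN.
Qed.

Lemma eq_ip_ae F F' G :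
  L2 Omega F -> L2 Omega F' -> L2 Omega G ->
  {ae leb R d, forall x, Omega x -> F x = F' x} -> ip Omega F G = ip Omega F' G.
Proof.
move=> LF LF' LG FF'; rewrite /ip /Rintegral; congr fine.
have mI (K : 'rV[R]_d -> 'M[R]_(m, n)) : L2 Omega K ->
    measurable_fun Omega (fun x => (\sum_i \sum_j K x i j * G x i j)%:E).
  move=> LK; apply: (@measurable_int _ _ _ (leb R d)).
  apply: integrable_bigsum => // i; apply: integrable_bigsum => // j.
  exact: (sqint_mul mO (LK i j) (LG i j)).
apply: ae_eq_integral => //; [exact: mI|exact: mI|].
by move: FF'; apply: filterS => x H Ox; rewrite H.
Qed.

End matrix_L2.

(** The parallelogram bound for the two components of the H^1 norm, put into the
form of a (non-sharp) triangle inequality. *)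
Lemma le_double_of_sqr_le (R : realDomainType) (a b c pa ga pb gb pc gc : R) :
  0 <= a -> 0 <= b -> 0 <= c ->
  a ^+ 2 = pa + ga -> b ^+ 2 = pb + gb -> c ^+ 2 = pc + gc ->
  pc <= 2 * pa + 2 * pb -> gc <= 2 * ga + 2 * gb -> c <= 2 * a + 2 * b.
Proof.
move=> a0 b0 c0 Ea Eb Ec Hp Hg.
rewrite -(@ler_pXn2r _ 2)// ?nnegrE// ?addr_ge0// ?mulr_ge0//.
have : c ^+ 2 <= 2 * a ^+ 2 + 2 * b ^+ 2 by rewrite Ea Eb Ec; lra.
have : 0 <= a * b by rewrite mulr_ge0.
have := sqr_ge0 a; have := sqr_ge0 b.
by rewrite sqrrD !exprMn; lra.
Qed.

Section sobolev.
Context (R : realType) (d : nat) (Omega : set 'rV[R]_d).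
Hypothesis oO : open Omega.
Let mO : measurable Omega := open_measurable_rV oO.
Local Notation sqint := (sqint (leb R d) Omega).
Implicit Types (v w : field_grad R d) (phi : 'rV[R]_d -> R).

Lemma test_field_L2 (Phi : 'rV[R]_d -> 'rV[R]_d) :
  (forall i, test_fun Omega (fun x => Phi x ord0 i)) ->
  L2 Omega (fval (classical_grad Phi)) /\ L2 Omega (grad (classical_grad Phi)).
Proof.
move=> tPhi; split => i j; first by rewrite ord1; exact: (test_fun_sqint mO (tPhi j)).
have := test_fun_pderiv_sqint mO j (tPhi i).
rewrite (_ : pderiv j _ = fun x => grad (classical_grad Phi) x i j); first exact.
by apply/funext => x; rewrite mxE.
Qed.

Lemma H1B v w : H1 Omega v -> H1 Omega w -> H1 Omega (v - w).
Proof.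
move=> [Lv Lgv wv] [Lw Lgw ww]; split; [exact: L2B|exact: L2B|].
move=> phi i j tphi.
have sp := test_fun_sqint mO tphi; have sdp := test_fun_pderiv_sqint mO j tphi.
transitivity (\int[leb R d]_(x in Omega) (fval v x ord0 i * pderiv j phi x)
   - \int[leb R d]_(x in Omega) (fval w x ord0 i * pderiv j phi x)).
  rewrite -RintegralB//; [|exact: (sqint_mul mO (Lv ord0 i) sdp)|exact: (sqint_mul mO (Lw ord0 i) sdp)].
  by apply: eq_Rintegral => x _; rewrite -mulrBl !mxE.
rewrite wv// ww// opprK addrC -opprB.
rewrite -RintegralB//; [|exact: (sqint_mul mO (Lgv i j) sp)|exact: (sqint_mul mO (Lgw i j) sp)].
by congr (- _); apply: eq_Rintegral => x _; rewrite -mulrBl !mxE.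
Qed.

Lemma norm_H1_sqr v : norm_H1 Omega v ^+ 2 =
  norm2 Omega (fval v) ^+ 2 + norm2 Omega (grad v) ^+ 2.
Proof. by rewrite sqr_sqrtr// addr_ge0// sqr_ge0. Qed.

Lemma norm_H1B_le v w : L2 Omega (fval v) -> L2 Omega (grad v) ->
  L2 Omega (fval w) -> L2 Omega (grad w) ->
  norm_H1 Omega (v - w) <= 2 * norm_H1 Omega v + 2 * norm_H1 Omega w.
Proof.
move=> Lv Lgv Lw Lgw.
apply: (le_double_of_sqr_le _ _ _ (norm_H1_sqr v) (norm_H1_sqr w) (norm_H1_sqr (v - w))).
- exact: sqrtr_ge0.
- exact: sqrtr_ge0.
- exact: sqrtr_ge0.
- exact: norm2_sqrB_le.
- exact: norm2_sqrB_le.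
Qed.

Lemma XB v w : X Omega v -> X Omega w -> X Omega (v - w).
Proof.
move=> [Hv [Phi [tPhi cPhi]]] [Hw [Psi [tPsi cPsi]]]; split; first exact: H1B.
exists (fun n x => Phi n x - Psi n x); split=> [n i|].
  have := test_funB (tPhi n i) (tPsi n i).
  by congr (test_fun _ _); apply/funext => x; rewrite !mxE.
have le_sum n : norm_H1 Omega (v - w - classical_grad (fun x => Phi n x - Psi n x)) <=
    2 * norm_H1 Omega (v - classical_grad (Phi n)) +
    2 * norm_H1 Omega (w - classical_grad (Psi n)).
  have -> : v - w - classical_grad (fun x => Phi n x - Psi n x) =
    (v - classical_grad (Phi n)) - (w - classical_grad (Psi n)).
    have -> : classical_grad (fun x => Phi n x - Psi n x) =
      classical_grad (Phi n) - classical_grad (Psi n).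
      congr pair; apply/funext => x; apply/matrixP => i j; rewrite !mxE.
      have dp := @test_fun_derivable _ _ _ _ j x (tPhi n i).
      have dq := @test_fun_derivable _ _ _ _ j x (tPsi n i).
      rewrite -(pderivB dp dq).
      rewrite (_ : (fun y => _) = fun y => Phi n y ord0 i - Psi n y ord0 i); first reflexivity.
      by apply/funext => y; rewrite !mxE.
    by rewrite !opprB addrACA [RHS]addrACA; congr (_ + _); rewrite addrC.
  have [[Lv Lgv _] [Lw Lgw _]] := (Hv, Hw).
  have [Lp Lgp] := test_field_L2 (tPhi n); have [Lq Lgq] := test_field_L2 (tPsi n).
  by apply: norm_H1B_le; exact: L2B.
apply: (@squeeze_cvgr _ _ _ _ (cst 0) (fun n =>
    2 * norm_H1 Omega (v - classical_grad (Phi n)) +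
    2 * norm_H1 Omega (w - classical_grad (Psi n)))).
- by apply: nearW => n; rewrite sqrtr_ge0/= le_sum.
- exact: cvg_cst.
rewrite [X in _ --> X](_ : _ = 2 * 0 + 2 * 0 :> R); last by rewrite !mulr0 addr0.
exact: (cvgD (cvgM (cvg_cst (2 : R)) cPhi) (cvgM (cvg_cst (2 : R)) cPsi)).
Qed.

Lemma X_add v w : X Omega v -> X Omega w -> X Omega (v + w).
Proof.
move=> Xv Xw; have X0 := XB Xv Xv; rewrite subrr in X0.
by have := XB Xv (XB X0 Xw); rewrite sub0r opprK.
Qed.

Lemma V_X v : V Omega v -> X Omega v.
Proof. by case. Qed.

Lemma V_sub v w : V Omega v -> V Omega w -> V Omega (v - w).
Proof.
move=> [Xv dv] [Xw dw]; split; first exact: XB.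
move=> q Qq; have [mq q2 _ _] := Qq.
have sq : sqint q by split.
have sdiv (z : field_grad R d) : X Omega z -> sqint (divergence z).
  by move=> [[_ Lg _] _]; apply: sqint_sum => // i; exact: Lg.
rewrite -[RHS](subrr 0) -{1}(dv _ Qq) -(dw _ Qq) -RintegralB//; last 2 first.
- exact: (sqint_mul mO (sdiv _ Xv) sq).
- exact: (sqint_mul mO (sdiv _ Xw) sq).
apply: eq_Rintegral => x _; rewrite -mulrBl; congr (_ * _).
by rewrite -[LHS]/(\tr (grad v x - grad w x)) raddfB.
Qed.

(** The limit in the definition of X, unfolded into sums of scalar integrals. *)
Lemma X_approx v : X Omega v -> forall e : R, 0 < e ->
  exists Phi : 'rV[R]_d -> 'rV[R]_d,
    (forall i, test_fun Omega (fun x => Phi x ord0 i)) /\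
    (\sum_i \int[leb R d]_(x in Omega) ((fval v x ord0 i - Phi x ord0 i) ^+ 2) +
     \sum_i \sum_j \int[leb R d]_(x in Omega)
       ((grad v x i j - pderiv j (fun y => Phi y ord0 i) x) ^+ 2) <= e).
Proof.
move=> [[Lv Lgv _] [Phi [tPhi cPhi]]] e e0.
pose t := Num.min 1 e; have t0 : 0 < t by rewrite lt_min ltr01.
have /cvgr_dist_lt/(_ _ t0)/filter_ex[n /= Hn] := cPhi.
exists (Phi n); split; first exact: tPhi.
have [Lp Lgp] := test_field_L2 (tPhi n).
have Lvp : L2 Omega (fval (v - classical_grad (Phi n))) by exact: L2B.
have Lgvp : L2 Omega (grad (v - classical_grad (Phi n))) by exact: L2B.
have := norm_H1_sqr (v - classical_grad (Phi n)).
rewrite (norm2_sqrE mO Lvp) (norm2_sqrE mO Lgvp) big_ord1 => EH.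
have -> : \sum_i \int[leb R d]_(x in Omega) ((fval v x ord0 i - Phi n x ord0 i) ^+ 2) =
    \sum_j \int[leb R d]_(x in Omega) (fval (v - classical_grad (Phi n)) x ord0 j ^+ 2).
  by apply: eq_bigr => i _; apply: eq_Rintegral => x _; rewrite !mxE.
have -> : \sum_i \sum_j \int[leb R d]_(x in Omega)
       ((grad v x i j - pderiv j (fun y => Phi n y ord0 i) x) ^+ 2) =
    \sum_i \sum_j \int[leb R d]_(x in Omega) (grad (v - classical_grad (Phi n)) x i j ^+ 2).
  by apply: eq_bigr => i _; apply: eq_bigr => j _; apply: eq_Rintegral => x _; rewrite !mxE.
rewrite -EH; move: Hn; rewrite sub0r normrN ger0_norm ?sqrtr_ge0// => Hn.
have N0 : 0 <= norm_H1 Omega (v - classical_grad (Phi n)) by exact: sqrtr_ge0.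
have t1 : t <= 1 by rewrite ge_min lexx.
have te : t <= e by rewrite ge_min lexx orbT.
rewrite expr2 (le_trans _ te)// -[leRHS]mul1r.
by apply: ler_pM => //; [exact: le_trans (ltW Hn) t1|exact: ltW].
Qed.

End sobolev.

(** * Fourth powers of H^1_0 functions *)

Lemma ler_term_sum (R : numDomainType) (I : finType) (F : I -> R) i :
  (forall j, 0 <= F j) -> F i <= \sum_j F j.
Proof. by move=> F0; rewrite (bigD1 i)//= lerDl sumr_ge0. Qed.

Section skew_symmetry.
Context (R : realType) (d : nat) (Omega : set 'rV[R]_d).
Hypothesis oO : open Omega.
Hypothesis hd : d = 2%N \/ d = 3%N.
Let mO : measurable Omega := open_measurable_rV oO.
Local Notation sqint := (sqint (leb R d) Omega).
Implicit Types (v w : field_grad R d) (phi f h : 'rV[R]_d -> R)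
  (g : 'I_d -> 'rV[R]_d -> R).

Definition sqr_normH1 f g : R :=
  \int[leb R d]_(x in Omega) (f x ^+ 2) +
  \sum_j \int[leb R d]_(x in Omega) (g j x ^+ 2).

(** The scalar space H^1_0, with g in the role of the gradient of f: the pairs
that test functions approximate in the H^1 norm. A component of a field of X
and the corresponding row of its gradient form such a pair. *)
Definition H10 f g := [/\ sqint f, forall j, sqint (g j) &
  forall e : R, 0 < e -> exists phi, test_fun Omega phi /\
    sqr_normH1 (fun x => f x - phi x) (fun j x => g j x - pderiv j phi x) <= e].

Lemma X_H10 v i : X Omega v ->
  H10 (fun x => fval v x ord0 i) (fun j x => grad v x i j).
Proof.
move=> Xv; have [[Lv Lgv _] _] := Xv; split; [exact: Lv|exact: Lgv|].
move=> e /(X_approx oO Xv)[Phi [tPhi HPhi]].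
exists (fun x => Phi x ord0 i); split; first exact: tPhi.
apply: le_trans HPhi; rewrite /sqr_normH1.
have ge0 (F : 'rV[R]_d -> R) : 0 <= \int[leb R d]_(x in Omega) (F x ^+ 2).
  by apply: Rintegral_ge0 => x _; exact: sqr_ge0.
apply: lerD; first by apply: ler_term_sum => k; exact: ge0.
apply: (ler_term_sum (F := fun k => \sum_j \int[leb R d]_(x in Omega)
  ((grad v x k j - pderiv j (fun y => Phi y ord0 k) x) ^+ 2))) => k.
by apply: sumr_ge0 => j _; exact: ge0.
Qed.

Lemma H10_sub_test f g phi : test_fun Omega phi -> H10 f g ->
  H10 (fun x => f x - phi x) (fun j x => g j x - pderiv j phi x).
Proof.
move=> tphi [sf sg H]; split.
- exact: sqintB (test_fun_sqint mO tphi).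
- by move=> j; exact: sqintB (test_fun_pderiv_sqint mO j tphi).
move=> e /H[psi [tpsi Hpsi]].
exists (fun x => psi x - phi x); split; first exact: test_funB.
apply: le_trans Hpsi; rewrite le_eqVlt; apply/orP; left; apply/eqP.
rewrite /sqr_normH1; apply: f_equal2.
  by apply: eq_Rintegral => x _; congr (_ ^+ 2); ring.
apply: eq_bigr => j _; apply: eq_Rintegral => x _; congr (_ ^+ 2).
rewrite (pderivB (@test_fun_derivable _ _ _ _ j x tpsi) (@test_fun_derivable _ _ _ _ j x tphi)).
by rewrite opprB addrA subrK.
Qed.

Lemma integral_sqr_le_double f h : sqint f -> sqint h ->
  \int[leb R d]_(x in Omega) (h x ^+ 2) <=
  2 * \int[leb R d]_(x in Omega) (f x ^+ 2) +
  2 * \int[leb R d]_(x in Omega) ((f x - h x) ^+ 2).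
Proof.
move=> sf sh; have sfh := sqintB mO sf sh.
rewrite -!RintegralZl//; [|exact: sfh.2|exact: sf.2].
rewrite -RintegralD//; last 2 first.
- exact: (integrable_scale mO 2 sf.2).
- exact: (integrable_scale mO 2 sfh.2).
apply: le_Rintegral => //.
- exact: sh.2.
- exact: (integrable_addr mO (integrable_scale mO 2 sf.2) (integrable_scale mO 2 sfh.2)).
by move=> x _; have := sqr_ge0 (2 * f x - h x); rewrite !sqrrB exprMn; lra.
Qed.

Lemma sqr_normH1_ge0 f g : 0 <= sqr_normH1 f g.
Proof.
by apply: addr_ge0; [|apply: sumr_ge0 => j _];
  apply: Rintegral_ge0 => x _; exact: sqr_ge0.
Qed.

Lemma sqr_normH1_le_double f g phi : H10 f g -> test_fun Omega phi ->
  sqr_normH1 phi (fun j => pderiv j phi) <= 2 * sqr_normH1 f g +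
  2 * sqr_normH1 (fun x => f x - phi x) (fun j x => g j x - pderiv j phi x).
Proof.
move=> [sf sg _] tphi; rewrite /sqr_normH1 2!mulrDr addrACA; apply: lerD.
  by apply: integral_sqr_le_double => //; exact: test_fun_sqint.
rewrite 2!mulr_sumr -big_split; apply: ler_sum => j _ /=.
by apply: integral_sqr_le_double => //; exact: test_fun_pderiv_sqint.
Qed.

Lemma test_fun_sqint_sqr phi : test_fun Omega phi -> sqint (fun x => phi x ^+ 2).
Proof. by move=> /test_fun_sqr/(test_fun_sqint mO). Qed.

(** Ladyzhenskaya's inequality for a test function close to f in H^1 bounds each
truncation of f^4, uniformly in the level. The constant 8 instead of 2 pays for
|phi|^2 <= 2 |f|^2 + 2 |f - phi|^2. *)
Lemma H10_pow4_le f g : H10 f g -> sqint (fun x => f x ^+ 2) /\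
  \int[leb R d]_(x in Omega) ((f x ^+ 2) ^+ 2) <= 8 * sqr_normH1 f g ^+ 2.
Proof.
move=> Hf; have [sf sg Happ] := Hf; apply: sqint_sqr_of_trunc => // n.
set N := sqr_normH1 f g; have N0 : 0 <= N by exact: sqr_normH1_ge0.
apply: (@le_of_le_small _ _ _ (16 * N + 8 + 2 * n%:R * (2 + N))) => s s0 s1.
have s20 : 0 < s ^+ 2 by rewrite exprn_gt0.
have [phi [tphi Hphi]] := Happ _ s20.
have sp := test_fun_sqint mO tphi.
apply: (le_trans (integral_trunc_le mO (ler0n R n) s0 sf sp (test_fun_sqint_sqr tphi))).
(* the bound s^2 on the squared H^1 error makes the weight s^-1 below harmless *)
have E1 : \int[leb R d]_(x in Omega) ((f x - phi x) ^+ 2) <= s ^+ 2.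
  apply: le_trans Hphi; rewrite lerDl; apply: sumr_ge0 => j _.
  by apply: Rintegral_ge0 => x _; exact: sqr_ge0.
have N1 : \int[leb R d]_(x in Omega) (f x ^+ 2) <= N.
  rewrite lerDl; apply: sumr_ge0 => j _.
  by apply: Rintegral_ge0 => x _; exact: sqr_ge0.
have P4 := test_fun_pow4_le hd tphi.
have Een := sqr_normH1_le_double Hf tphi.
have en0 : 0 <= sqr_normH1 phi (fun j => pderiv j phi) by exact: sqr_normH1_ge0.
have P4' : \int[leb R d]_(x in Omega) ((phi x ^+ 2) ^+ 2) <=
    2 * sqr_normH1 phi (fun j => pderiv j phi) ^+ 2.
  apply: le_trans P4; rewrite le_eqVlt; apply/orP; left; apply/eqP.
  by apply: eq_Rintegral => x _; rewrite -exprM.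
have P4'' : \int[leb R d]_(x in Omega) ((phi x ^+ 2) ^+ 2) <=
    8 * N ^+ 2 + s * (16 * N + 8).
  apply: (le_trans P4').
  apply: (@le_trans _ _ (2 * (2 * N + 2 * s ^+ 2) ^+ 2)).
    have Es0 : 0 <= 2 * N + 2 * s ^+ 2 by move: s20; lra.
    rewrite ler_pM2l// ler_pXn2r// ?nnegrE//.
    by apply: (le_trans Een); rewrite lerD2l ler_pM2l.
  have s2s : s ^+ 2 <= s by rewrite expr2 -[leRHS]mulr1 ler_pM2l.
  have s4s : (s ^+ 2) ^+ 2 <= s.
    by apply: (le_trans _ s2s); rewrite ler_pXn2r// nnegrE (ltW s0, ltW s20).
  have : N * s ^+ 2 <= N * s by rewrite ler_wpM2l.
  rewrite sqrrD !exprMn; lra.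
rewrite [in leRHS]mulrDr [leRHS]addrA; apply: lerD => //.
rewrite [leRHS]mulrCA ler_wpM2l ?mulr_ge0//.
have sV : s^-1 * s ^+ 2 = s by rewrite expr2 mulrA mulVf ?mul1r// gt_eqF.
have H1 : s^-1 * \int[leb R d]_(x in Omega) ((f x - phi x) ^+ 2) <= s.
  by rewrite -[leRHS]sV ler_pM2l// invr_gt0.
have H2 : s * \int[leb R d]_(x in Omega) (f x ^+ 2) <= s * N by rewrite ler_pM2l.
have s2s : s ^+ 2 <= s by rewrite expr2 -[leRHS]mulr1 ler_pM2l.
rewrite mulrDr; move: H1 H2 E1; lra.
Qed.

Lemma divergence_sqint v : X Omega v -> sqint (divergence v).
Proof. by move=> [[_ Lg _] _]; apply: sqint_sum => // i; exact: Lg. Qed.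

End skew_symmetry.

(** * Weakly divergence-free fields *)

Section divergence_free.
Context (R : realType) (d : nat) (Omega : set 'rV[R]_d).
Hypothesis oO : open Omega.
Hypothesis hd : d = 2%N \/ d = 3%N.
Let mO : measurable Omega := open_measurable_rV oO.
Local Notation sqint := (sqint (leb R d) Omega).
Implicit Types (u v w : field_grad R d) (phi f h : 'rV[R]_d -> R).

Lemma sqr_indic (A : set 'rV[R]_d) x : (\1_A x : R) ^+ 2 = \1_A x.
Proof. by rewrite indicE; case: (_ \in _); rewrite ?expr1n ?expr0n. Qed.

Section indicator.
Context (A : set 'rV[R]_d).
Hypothesis mA : measurable A.
Hypothesis AO : A `<=` Omega.
Hypothesis Afin : (leb R d A < +oo)%E.

Lemma integrable_indic_sub :
  (leb R d).-integrable Omega (EFin \o (\1_A : 'rV[R]_d -> R)).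
Proof.
apply/integrableP; split; first by apply/measurable_EFinP.
under eq_integral do rewrite /= ger0_norm//.
by rewrite integral_indic// setIidl.
Qed.

Lemma sqint_indic : sqint (\1_A : 'rV[R]_d -> R).
Proof.
split; first exact: measurable_funTS.
rewrite (_ : (fun x => _) = EFin \o (\1_A : 'rV[R]_d -> R)).
  exact: integrable_indic_sub.
by apply/funext => x /=; rewrite sqr_indic.
Qed.

Lemma Rintegral_indic_sub :
  \int[leb R d]_(x in Omega) (\1_A x : R) = fine (leb R d A).
Proof. by rewrite /Rintegral integral_indic// setIidl. Qed.

(** The function phi - c 1_A, with c = \int phi / |A|, has mean zero and is thus
a legitimate test of the constraint that defines V. *)
Lemma integral_divergence_indic v phi : V Omega v -> test_fun Omega phi ->
  (0 < leb R d A)%E ->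
  \int[leb R d]_(x in Omega) (divergence v x * phi x) * fine (leb R d A) =
  \int[leb R d]_(x in Omega) phi x *
  \int[leb R d]_(x in Omega) (divergence v x * \1_A x).
Proof.
move=> [Xv dv] tphi A0.
have sphi := test_fun_sqint mO tphi.
have sdiv := divergence_sqint oO Xv.
have iphi : (leb R d).-integrable Omega (EFin \o phi).
  apply: (integrableS measurableT) => //.
  exact: (Cc_integrable (C1c_Cc (test_fun_C1c tphi))).
have a0 : 0 < fine (leb R d A) by rewrite fine_gt0// A0.
set a := fine _ in a0 *.
pose c := \int[leb R d]_(x in Omega) phi x / a.
have i1 := integrable_scale mO c integrable_indic_sub.
have sq1 := sqintZ mO c sqint_indic.
have sq := sqintB mO sphi sq1.
have := dv (fun x => phi x - c * \1_A x).
have -> : \int[leb R d]_(x in Omega) (divergence v x * (phi x - c * \1_A x)) =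
   \int[leb R d]_(x in Omega) (divergence v x * phi x) -
   c * \int[leb R d]_(x in Omega) (divergence v x * \1_A x).
  have j1 := sqint_mul mO sdiv sphi.
  have j2 := sqint_mul mO sdiv sqint_indic.
  rewrite -(RintegralZl _ mO j2) -(RintegralB mO j1 (integrable_scale mO c j2)).
  by apply: eq_Rintegral => x _; ring.
move=> H; have {H} : \int[leb R d]_(x in Omega) (divergence v x * phi x) -
   c * \int[leb R d]_(x in Omega) (divergence v x * \1_A x) = 0.
  apply: H; split; [exact: sq.1|exact: sq.2|exact: (integrable_subr mO iphi i1)|].
  rewrite (RintegralB mO iphi i1) (RintegralZl _ mO integrable_indic_sub).
  by rewrite Rintegral_indic_sub -/a /c divfK ?subrr// gt_eqF.
move/eqP; rewrite subr_eq0 => /eqP ->.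
by rewrite mulrAC /c divfK// gt_eqF.
Qed.

End indicator.

(** The divergence of a test field integrates to zero, and on a set of finite
measure L^2 convergence implies convergence of the integrals. *)
Lemma integral_divergence_X v : X Omega v -> (leb R d Omega < +oo)%E ->
  \int[leb R d]_(x in Omega) divergence v x = 0.
Proof.
move=> Xv finO; have sdiv := divergence_sqint oO Xv.
have i1 : (leb R d).-integrable Omega (EFin \o (fun=> 1 : R)).
  apply/integrableP; split; first by apply/measurable_EFinP; exact: measurable_cst.
  by under eq_integral do rewrite /= normr1; rewrite integral_cst// mul1e.
have s1 : sqint (fun=> 1).
  by split; [exact: measurable_cst|under eq_fun do rewrite expr1n].
set m := fine (leb R d Omega).
apply/eqP; rewrite -normr_le0.
apply: (@le_of_le_small _ _ _ (d%:R * (m + 1))) => s s0 s1'; rewrite add0r.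
have s20 : 0 < s ^+ 2 by rewrite exprn_gt0.
have [Phi [tPhi HPhi]] := X_approx oO Xv s20.
have [[_ Lgv _] _] := Xv.
have sa i : sqint (fun x => grad v x i i - pderiv i (fun y => Phi y ord0 i) x).
  exact: (sqintB mO (Lgv i i) (test_fun_pderiv_sqint mO i (tPhi i))).
have int1 (F : 'rV[R]_d -> R) : sqint F -> (leb R d).-integrable Omega (EFin \o F).
  move=> sF; have := sqint_mul mO sF s1.
  by rewrite (_ : (fun x => F x * 1) = F)//; apply/funext => x; rewrite mulr1.
have -> : \int[leb R d]_(x in Omega) divergence v x = \sum_i
    \int[leb R d]_(x in Omega) (grad v x i i - pderiv i (fun y => Phi y ord0 i) x).
  rewrite /divergence /mxtrace Rintegral_sum//; last by move=> i; apply: int1; exact: Lgv.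
  apply: eq_bigr => i _.
  rewrite RintegralB//; [|exact: int1 (Lgv i i)|].
    by rewrite integral_pderiv_test_fun ?subr0.
  exact: int1 (test_fun_pderiv_sqint mO i (tPhi i)).
apply: (le_trans (ler_norm_sum _ _ _)).
apply: (@le_trans _ _ (\sum_(i < d) s * (m + 1))); last first.
  rewrite sumr_const card_ord [leRHS]mulrCA mulr_natl; exact: lexx.
apply: ler_sum => i _; set a := fun x => _ - _.
have sai : sqint a by exact: sa.
have ia2 : (leb R d).-integrable Omega (EFin \o (fun x => a x ^+ 2)) by exact: sai.2.
have k1 := integrable_scale mO s i1; have k2 := integrable_scale mO s^-1 ia2.
(* |a| <= s + a^2 / s, and the integral of a^2 is at most s^2 *)
apply: (@le_trans _ _ (\int[leb R d]_(x in Omega) (s * 1 + s^-1 * a x ^+ 2))).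
  apply: normr_Rintegral_le => //; [exact: sai.1| |exact: integrable_addr].
  move=> x _; rewrite -[X in `|X|]/(a x) mulr1; move: (a x) => b.
  rewrite -(ler_pM2l s0) mulrDr mulrA mulfV ?gt_eqF// mul1r.
  have := sqr_ge0 (s - `|b|); rewrite sqrrB real_normK ?num_real//.
  have := mulr_ge0 (ltW s0) (normr_ge0 b); lra.
rewrite (RintegralD mO k1 k2) (RintegralZl _ mO i1) (RintegralZl _ mO ia2).
rewrite Rintegral_cst// mul1r mulrDr lerD2l mulr1.
rewrite -(ler_pM2l s0) mulrA mulfV ?gt_eqF// mul1r -expr2.
have ge0 (F : 'rV[R]_d -> R) : 0 <= \int[leb R d]_(x in Omega) (F x ^+ 2).
  by apply: Rintegral_ge0 => x _; exact: sqr_ge0.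
apply: le_trans HPhi; apply: ler_wpDl; first by apply: sumr_ge0 => k _; exact: ge0.
pose F k j := \int[leb R d]_(x in Omega)
  ((grad v x k j - pderiv j (fun y => Phi y ord0 k) x) ^+ 2).
apply: (@le_trans _ _ (\sum_j F i j)).
  by apply: (ler_term_sum (F := F i)) => j; exact: ge0.
apply: (ler_term_sum (F := fun k => \sum_j F k j)) => k.
by apply: sumr_ge0 => j _; exact: ge0.
Qed.

(** Continuity from below along the intersections of Omega with growing cubes. *)
Lemma exists_large_finite_measure (K : R) : (leb R d Omega = +oo)%E ->
  exists A, [/\ measurable A, A `<=` Omega, (leb R d A < +oo)%E & (K%:E < leb R d A)%E].
Proof.
move=> Oy; pose A n := Omega `&` open_cube 0 n%:R.
have mA n : measurable (A n) by apply: measurableI => //; exact: measurable_open_cube.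
have Afin n : (leb R d (A n) < +oo)%E.
  apply: (@le_lt_trans _ _ (leb R d (open_cube 0 n%:R))).
    by apply: le_measure; rewrite ?inE//; [exact: measurable_open_cube|exact: subIsetr].
  by rewrite leb_open_cube// ltry.
apply: contrapT => H.
have Ale n : (leb R d (A n) <= K%:E)%E.
  rewrite leNgt; apply/negP => KA; apply: H; exists (A n); split => //.
  exact: subIsetl.
have AO : \bigcup_n A n = Omega.
  rewrite -setI_bigcupr; apply/setIidPl => x _.
  have [n _ xn] : \forall n \near \oo, `|x| < n%:R by exact: nbhs_infty_gtr.
  exists n => // i; rewrite mxE subr0; apply: le_lt_trans (xn n (leqnn n)).
  rewrite [leRHS]/Num.norm /= mx_normrE; apply/bigmax_geP; right => /=.
  by exists (ord0, i).
have ndA : nondecreasing_seq A.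
  move=> n k nk; apply/subsetPset => x [Ox xn]; split => // i.
  by apply: lt_le_trans (xn i) _; rewrite ler_nat.
have mU : measurable (\bigcup_n A n) by rewrite AO.
have cA : leb R d \o A @ \oo --> leb R d (\bigcup_n A n).
  exact: nondecreasing_cvg_mu.
rewrite AO Oy in cA.
have : (+oo <= K%:E)%E.
  by rewrite -(cvg_lim _ cA)//; apply: lime_le; [apply/cvg_ex; exists +oo%E|exact: nearW].
by rewrite leye_eq.
Qed.

(** In infinite measure, [integral_divergence_indic] and Cauchy-Schwarz bound the
square of the integral by (\int phi)^2 (\int (div v)^2) / |A|, with |A|
arbitrarily large. *)
Lemma integral_divergence_test v phi : V Omega v -> test_fun Omega phi ->
  \int[leb R d]_(x in Omega) (divergence v x * phi x) = 0.
Proof.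
move=> Vv tphi; have [Xv _] := Vv.
have [finO|] := ltP (leb R d Omega) +oo%E.
  have [nul|nul] := eqVneq (leb R d Omega) 0%E.
    by rewrite /Rintegral null_set_integral//;
      apply: measurable_int; exact: (sqint_mul mO (divergence_sqint oO Xv) (test_fun_sqint mO tphi)).
  have Opos : (0 < leb R d Omega)%E by rewrite lt0e nul measure_ge0.
  have := integral_divergence_indic mO (@subset_refl _ Omega) finO Vv tphi Opos.
  rewrite [X in _ = _ * X](_ : _ = 0); last first.
    rewrite -(integral_divergence_X Xv finO); apply: eq_Rintegral => x xO.
    by rewrite indicE xO mulr1.
  move/eqP; rewrite mulr0 mulf_eq0 => /orP[/eqP//|].
  by rewrite gt_eqF// fine_gt0// Opos.
rewrite leye_eq => /eqP Oy.
set P := \int[leb R d]_(x in Omega) phi x.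
set G := \int[leb R d]_(x in Omega) (divergence v x ^+ 2).
apply/eqP/negPn/negP; set L := Rintegral _ _ _ => L0.
have L20 : 0 < L ^+ 2 by rewrite exprn_even_gt0.
have [A [mA AO Afin KA]] := exists_large_finite_measure (P ^+ 2 * G / L ^+ 2) Oy.
have G0 : 0 <= G by apply: Rintegral_ge0 => x _; exact: sqr_ge0.
have A0 : (0 < leb R d A)%E.
  apply: le_lt_trans KA; rewrite lee_fin; apply: divr_ge0; last exact: ltW.
  by rewrite mulr_ge0// sqr_ge0.
have := integral_divergence_indic mA AO Afin Vv tphi A0.
have := cauchy_schwarz_Rintegral mO (divergence_sqint oO Xv) (sqint_indic mA AO Afin).
under [X in _ <= _ * X -> _]eq_Rintegral do rewrite sqr_indic.
rewrite (Rintegral_indic_sub mA AO).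
have {}KA : P ^+ 2 * G / L ^+ 2 < fine (leb R d A).
  by rewrite -lte_fin fineK// ge0_fin_numE.
have a0 : 0 < fine (leb R d A) by rewrite fine_gt0// A0.
move: KA a0; set a := fine _ => KA a0.
rewrite -/G -/L -/P; set J := Rintegral _ _ _ => HJ HL.
have : (L * a) ^+ 2 <= P ^+ 2 * (G * a) by rewrite HL exprMn ler_wpM2l// sqr_ge0.
rewrite exprMn mulrA [a ^+ 2]expr2 (mulrA _ a a) ler_pM2r// leNgt => /negP; apply.
by rewrite [ltRHS]mulrC -ltr_pdivrMr.
Qed.

End divergence_free.

(** * The convective form *)

Section convection.
Context (R : realType) (d : nat) (Omega : set 'rV[R]_d).
Hypothesis oO : open Omega.
Hypothesis hd : d = 2%N \/ d = 3%N.
Let mO : measurable Omega := open_measurable_rV oO.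
Local Notation sqint := (sqint (leb R d) Omega).
Implicit Types (u v w : field_grad R d) (phi f h : 'rV[R]_d -> R).

Lemma X_sqint_sqr v i : X Omega v -> sqint (fun x => fval v x ord0 i ^+ 2).
Proof. by move=> /(X_H10 oO i)/(H10_pow4_le oO hd)[]. Qed.

Lemma X_sqint v i : X Omega v -> sqint (fun x => fval v x ord0 i).
Proof. by move=> /(X_H10 oO i)[]. Qed.

Lemma X_sqint_mul u v i j : X Omega u -> X Omega v ->
  sqint (fun x => fval u x ord0 i * fval v x ord0 j).
Proof.
move=> Xu Xv; apply: sqint_mul_sqr => //.
- exact: (X_sqint i Xu).1.
- exact: (X_sqint j Xv).1.
- exact: X_sqint_sqr.
- exact: X_sqint_sqr.
Qed.

(** The product rule turns 2 phi d_j phi into the derivative of the test function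
phi^2, to which the definition of the weak gradient of u applies. *)
Lemma convection_test_fun u phi : V Omega u -> test_fun Omega phi ->
  \sum_j \int[leb R d]_(x in Omega) (fval u x ord0 j * phi x * pderiv j phi x) = 0.
Proof.
move=> Vu tphi; have [Xu _] := Vu; have [[Lu Lgu wu] _] := Xu.
have tphi2 := test_fun_sqr tphi.
have := integral_divergence_test oO Vu tphi2.
have -> : \int[leb R d]_(x in Omega) (divergence u x * phi x ^+ 2) =
    \sum_j \int[leb R d]_(x in Omega) (grad u x j j * phi x ^+ 2).
  rewrite -Rintegral_sum//; last first.
    by move=> j; exact: (sqint_mul mO (Lgu j j) (test_fun_sqint mO tphi2)).
  by apply: eq_Rintegral => x _; rewrite /divergence /mxtrace mulr_suml.
have E j : \int[leb R d]_(x in Omega) (grad u x j j * phi x ^+ 2) =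
    - 2 * \int[leb R d]_(x in Omega) (fval u x ord0 j * phi x * pderiv j phi x).
  have sup : sqint (fun x => fval u x ord0 j * phi x).
    apply: sqint_mul_sqr => //.
    - exact: (X_sqint j Xu).1.
    - exact: (test_fun_sqint mO tphi).1.
    - exact: X_sqint_sqr.
    - exact: (test_fun_sqint mO tphi2).
  rewrite -[LHS]opprK -(wu _ _ _ tphi2) mulNr; congr (- _).
  rewrite -(RintegralZl _ mO (sqint_mul mO sup (test_fun_pderiv_sqint mO j tphi))).
  apply: eq_Rintegral => x _.
  rewrite (pderiv_sqr (@test_fun_derivable _ _ _ _ j x tphi)); ring.
rewrite (eq_bigr _ (fun j _ => E j)) -mulr_sumr => /eqP.
by rewrite mulf_eq0 oppr_eq0 pnatr_eq0 => /eqP.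
Qed.

(** Density: the error between f and a test function is of order s by
[trilinear_close], the closeness in L^4 being [H10_pow4_le] applied to the
difference. *)
Lemma convection_H10 u f g : V Omega u -> H10 Omega f g ->
  \sum_j \int[leb R d]_(x in Omega) (fval u x ord0 j * f x * g j x) = 0.
Proof.
move=> Vu Hf; have [Xu _] := Vu; have [sf sg Happ] := Hf.
pose C j := \int[leb R d]_(x in Omega) ((fval u x ord0 j * f x) ^+ 2)
  + 2 * \int[leb R d]_(x in Omega) (g j x ^+ 2) + 2
  + \int[leb R d]_(x in Omega) ((fval u x ord0 j ^+ 2) ^+ 2) + 9.
apply/eqP; rewrite -normr_le0; apply: (@le_of_le_small _ _ _ (\sum_j C j)) => s s0 s1.
have s20 : 0 < s ^+ 2 by rewrite exprn_gt0.
have [phi [tphi Hphi]] := Happ _ s20.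
have Hd := H10_sub_test oO tphi Hf.
have [sd4 d4] := H10_pow4_le oO hd Hd.
rewrite add0r; have -> : \sum_j \int[leb R d]_(x in Omega) (fval u x ord0 j * f x * g j x) =
  \sum_j (\int[leb R d]_(x in Omega) (fval u x ord0 j * f x * g j x) -
    \int[leb R d]_(x in Omega) (fval u x ord0 j * phi x * pderiv j phi x)).
  by rewrite sumrB (convection_test_fun Vu tphi) subr0.
apply: (le_trans (ler_norm_sum _ _ _)); rewrite mulr_sumr; apply: ler_sum => j _.
have ge0 (F : 'rV[R]_d -> R) : 0 <= \int[leb R d]_(x in Omega) (F x ^+ 2).
  by apply: Rintegral_ge0 => x _; exact: sqr_ge0.
apply: trilinear_close => //.
- exact: (X_sqint j Xu).1.
- exact: sf.1.
- exact: (test_fun_sqint mO tphi).1.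
- exact: (test_fun_pderiv_sqint mO j tphi).
- exact: X_sqint_sqr.
- exact: (H10_pow4_le oO hd Hf).1.
- exact: test_fun_sqint_sqr.
- apply: le_trans Hphi; rewrite /sqr_normH1; apply: ler_wpDl; first exact: ge0.
  apply: (ler_term_sum (F := fun k => \int[leb R d]_(x in Omega)
    ((g k x - pderiv k phi x) ^+ 2))) => k; exact: ge0.
- apply: (le_trans d4); rewrite ler_pM2l// -[s ^+ 4]/(s ^+ (2 * 2)) exprM.
  rewrite ler_pXn2r// nnegrE ?(ltW s20)//; exact: sqr_normH1_ge0.
Qed.

Lemma b_integrandE u w v : b Omega u w v =
  \int[leb R d]_(x in Omega) (\sum_i \sum_j
    (fval u x ord0 j * fval v x ord0 i * grad w x i j)).
Proof.
apply: eq_Rintegral => x _; rewrite big_ord1; apply: eq_bigr => i _.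
rewrite /convect mxE mulr_suml; apply: eq_bigr => j _.
by rewrite mxE mulrAC.
Qed.

Lemma bE u w v : X Omega u -> X Omega w -> X Omega v ->
  b Omega u w v = \sum_i \sum_j
    \int[leb R d]_(x in Omega) (fval u x ord0 j * fval v x ord0 i * grad w x i j).
Proof.
move=> Xu Xw Xv; have [[_ Lgw _] _] := Xw.
have I i j := sqint_mul mO (X_sqint_mul j i Xu Xv) (Lgw i j).
rewrite b_integrandE Rintegral_sum//; last by move=> i; apply: integrable_bigsum.
by apply: eq_bigr => i _; rewrite Rintegral_sum.
Qed.

Lemma b_skew u w : V Omega u -> X Omega w -> b Omega u w w = 0.
Proof.
move=> Vu Xw; have [Xu _] := Vu; rewrite (bE Xu Xw Xw).
by apply: big1 => i _; exact: (convection_H10 Vu (X_H10 oO i Xw)).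
Qed.

Lemma bBl u u' w v : X Omega u -> X Omega u' -> X Omega w -> X Omega v ->
  b Omega (u - u') w v = b Omega u w v - b Omega u' w v.
Proof.
move=> Xu Xu' Xw Xv; have [[_ Lgw _] _] := Xw.
rewrite (bE (XB oO Xu Xu') Xw Xv) (bE Xu Xw Xv) (bE Xu' Xw Xv).
rewrite -sumrB; apply: eq_bigr => i _; rewrite -sumrB; apply: eq_bigr => j _.
rewrite -(RintegralB mO (sqint_mul mO (X_sqint_mul j i Xu Xv) (Lgw i j))
  (sqint_mul mO (X_sqint_mul j i Xu' Xv) (Lgw i j))).
by apply: eq_Rintegral => x _; rewrite !mxE; ring.
Qed.

Lemma bBm u w w' v : X Omega u -> X Omega w -> X Omega w' -> X Omega v ->
  b Omega u (w - w') v = b Omega u w v - b Omega u w' v.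
Proof.
move=> Xu Xw Xw' Xv; have [[_ Lgw _] _] := Xw; have [[_ Lgw' _] _] := Xw'.
rewrite (bE Xu (XB oO Xw Xw') Xv) (bE Xu Xw Xv) (bE Xu Xw' Xv).
rewrite -sumrB; apply: eq_bigr => i _; rewrite -sumrB; apply: eq_bigr => j _.
rewrite -(RintegralB mO (sqint_mul mO (X_sqint_mul j i Xu Xv) (Lgw i j))
  (sqint_mul mO (X_sqint_mul j i Xu Xv) (Lgw' i j))).
by apply: eq_Rintegral => x _; rewrite !mxE; ring.
Qed.

End convection.

(** * The convective form against a bounded gradient *)

Lemma sum_cauchy_schwarz (R : realFieldType) (I : finType) (a c : I -> R) :
  (\sum_i a i * c i) ^+ 2 <= (\sum_i a i ^+ 2) * (\sum_i c i ^+ 2).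
Proof.
apply: discriminant_le => [|t]; first by apply: sumr_ge0 => i _; exact: sqr_ge0.
rewrite !mulr_sumr -!big_split/=; apply: sumr_ge0 => i _.
rewrite (_ : _ + _ = (a i + t * c i) ^+ 2) ?sqr_ge0//; ring.
Qed.

Section convection_bound.
Context (R : realType) (d : nat) (Omega : set 'rV[R]_d).
Hypothesis oO : open Omega.
Hypothesis hd : d = 2%N \/ d = 3%N.
Let mO : measurable Omega := open_measurable_rV oO.
Local Notation sqint := (sqint (leb R d) Omega).

(** The pointwise norm whose essential supremum is [norm_infty]. *)
Definition frobenius m n (F : 'rV[R]_d -> 'M[R]_(m, n)) (x : 'rV[R]_d) : R :=
  Num.sqrt (\sum_i \sum_j F x i j ^+ 2).

Lemma sum_sqr_ge0 m n (A : 'M[R]_(m, n)) : 0 <= \sum_i \sum_j A i j ^+ 2.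
Proof. by apply: sumr_ge0 => i _; apply: sumr_ge0 => j _; exact: sqr_ge0. Qed.

Lemma frobenius_sqint m n (F : 'rV[R]_d -> 'M[R]_(m, n)) : L2 Omega F ->
  sqint (frobenius F) /\
  \int[leb R d]_(x in Omega) (frobenius F x ^+ 2) = norm2 Omega F ^+ 2.
Proof.
move=> LF.
have sE x : frobenius F x ^+ 2 = \sum_i \sum_j F x i j ^+ 2.
  by rewrite sqr_sqrtr// sum_sqr_ge0.
have iF i : (leb R d).-integrable Omega (EFin \o (fun x => \sum_j F x i j ^+ 2)).
  by apply: integrable_bigsum => // j; exact: (LF i j).2.
have iFF := integrable_bigsum mO iF.
split; last first.
  rewrite norm2_sqrE//; under eq_Rintegral do rewrite sE.
  rewrite Rintegral_sum//; apply: eq_bigr => i _; rewrite Rintegral_sum// => j.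
  exact: (LF i j).2.
split; last by under eq_fun do rewrite sE.
apply: (measurableT_comp (continuous_measurable_fun (@sqrt_continuous R))).
by apply/measurable_EFinP; exact: measurable_int _ iFF.
Qed.

Lemma norm_infty_ae (u : field_grad R d) (K : R) : norm_infty Omega (grad u) = K%:E ->
  0 <= K /\ {ae leb R d, forall x, Omega x -> frobenius (grad u) x <= K}.
Proof.
move=> HK; split.
  by rewrite -lee_fin -HK; exact: Lnorm_ge0.
move: HK; rewrite /norm_infty unlock.
case: ifPn => [_ HK|mu0 _].
  have := ess_sup_ge (leb R d) (abse \o ((fun x => (frobenius (grad u) x)%:E) \_ Omega)).
  have -> : ess_sup (leb R d)
    (abse \o ((fun x => (frobenius (grad u) x)%:E) \_ Omega)) = K%:E by exact: HK.
  apply: filterS => x /= + Ox; rewrite patchE ifT ?inE//= lee_fin.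
  by rewrite ger0_norm// sqrtr_ge0.
exists setT; split => //.
by apply/eqP; move: mu0; rewrite -leNgt measure_le0.
Qed.

(** Cauchy-Schwarz over the pairs (i, j), the tensor product of e and v having
norm |e| |v|. *)
Lemma convection_le (e v : 'rV[R]_d) (A : 'M[R]_d) :
  `|\sum_i \sum_j (e ord0 j * v ord0 i * A i j)| <=
  Num.sqrt (\sum_i \sum_j A i j ^+ 2) *
  (Num.sqrt (\sum_i \sum_j e i j ^+ 2) * Num.sqrt (\sum_i \sum_j v i j ^+ 2)).
Proof.
rewrite -!sqrtrM ?sum_sqr_ge0// -sqrtr_sqr ler_sqrt; last first.
  by rewrite !mulr_ge0 ?sum_sqr_ge0.
rewrite pair_bigA/=; apply: le_trans (sum_cauchy_schwarz _ _) _.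
rewrite mulrC pair_bigA/= ler_wpM2l//.
  by apply: sumr_ge0 => i _; exact: sqr_ge0.
rewrite !big_ord1 mulrC big_distrlr/= pair_bigA/=.
by apply: ler_sum => -[i j] _ /=; rewrite exprMn mulrC.
Qed.

Lemma norm_b_le (e u v : field_grad R d) (K : R) : X Omega e -> X Omega u -> X Omega v ->
  norm_infty Omega (grad u) = K%:E ->
  `|b Omega e u v| <= K * (norm2 Omega (fval e) * norm2 Omega (fval v)).
Proof.
move=> Xe Xu Xv /norm_infty_ae[K0 aeK].
have [[Le _ _] _] := Xe; have [[Lv _ _] _] := Xv; have [[_ Lgu _] _] := Xu.
have [se ie] := frobenius_sqint Le; have [sv iv] := frobenius_sqint Lv.
have I : (leb R d).-integrable Omega (EFin \o (fun x => \sum_i \sum_j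
    (fval e x ord0 j * fval v x ord0 i * grad u x i j))).
  apply: integrable_bigsum => // i; apply: integrable_bigsum => // j.
  exact: (sqint_mul mO (X_sqint_mul oO hd j i Xe Xv) (Lgu i j)).
rewrite b_integrandE; apply: (le_trans (le_normr_Rintegral mO I)).
have iev := sqint_mul mO se sv.
have iK := integrable_scale mO K iev.
apply: (@le_trans _ _ (\int[leb R d]_(x in Omega)
   (K * (frobenius (fval e) x * frobenius (fval v) x)))).
  have iN := integrable_norm I.
  rewrite -lee_fin (EFin_Rintegral mO iN) (EFin_Rintegral mO iK).
  apply: ae_ge0_le_integral => //.
  - by move=> x _; rewrite lee_fin normr_ge0.
  - exact: (measurable_int _ iN).
  - by move=> x _; rewrite lee_fin !mulr_ge0// sqrtr_ge0.
  - exact: (measurable_int _ iK).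
  move: aeK; apply: filterS => x H Ox; rewrite lee_fin.
  apply: (le_trans (convection_le _ _ _)).
  by rewrite ler_wpM2r ?mulr_ge0 ?sqrtr_ge0//; exact: H.
rewrite (RintegralZl _ mO iev) ler_wpM2l//.
apply: (le_trans (ler_norm _)).
rewrite -(@ler_pXn2r _ 2)// ?nnegrE ?mulr_ge0 ?norm2_ge0//.
rewrite real_normK ?num_real// exprMn -ie -iv.
exact: cauchy_schwarz_Rintegral.
Qed.

End convection_bound.

(** * One step of the iteration *)

Section error_estimate.
Context (R : realFieldType).

(** Four times the hypothesis, with Young's inequality on each product: the
weights are chosen so that the two convective terms each cost a^2, and the
gradient term is absorbed with factor 2. *)
Lemma energy_absorption (nu mu B K G J eta a : R) :
  0 <= mu -> B ^+ 2 <= nu / 2 -> 4 * K ^+ 2 <= mu ->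
  nu * G ^+ 2 + mu * J ^+ 2 <= mu * (eta * J) + a * (B * G + K * J) ->
  2 * (nu * G ^+ 2) + mu * J ^+ 2 <= 2 * a ^+ 2 + 2 * mu * eta ^+ 2.
Proof.
move=> mu0 HB HK H.
have H1 : 2 * (mu * (eta * J)) <= mu * eta ^+ 2 + mu * J ^+ 2.
  have := mulr_ge0 mu0 (sqr_ge0 (eta - J)); rewrite sqrrB; lra.
have H2 : 4 * (a * (B * G)) <= a ^+ 2 + 2 * (nu * G ^+ 2).
  have := sqr_ge0 (a - 2 * (B * G)).
  have := ler_wpM2r (sqr_ge0 G) HB; rewrite sqrrB !exprMn; lra.
have H3 : 4 * (a * (K * J)) <= a ^+ 2 + mu * J ^+ 2.
  have := sqr_ge0 (a - 2 * (K * J)).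
  have := ler_wpM2r (sqr_ge0 J) HK; rewrite sqrrB !exprMn; lra.
lra.
Qed.

(** The two bounds on lam are those of a minimum; they pair with the two terms of
E^2 <= 2 J^2 + 2 (CH G)^2. *)
Lemma lambda_bar_energy (nu mu CH G J E lam : R) : 0 <= lam ->
  0 <= CH -> lam * CH ^+ 2 <= nu -> lam * 2 <= mu ->
  0 <= E -> E <= J + CH * G -> lam * E ^+ 2 <= 2 * (nu * G ^+ 2) + mu * J ^+ 2.
Proof.
move=> lam0 CH0 Hnu Hmu E0 tri.
have E2 : E ^+ 2 <= 2 * J ^+ 2 + 2 * (CH * G) ^+ 2.
  apply: (@le_trans _ _ ((J + CH * G) ^+ 2)).
    by rewrite ler_pXn2r// nnegrE// (le_trans E0).
  have := sqr_ge0 (J - CH * G); rewrite sqrrB sqrrD; lra.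
have := ler_wpM2l lam0 E2.
have := ler_wpM2r (sqr_ge0 G) Hnu; have := ler_wpM2r (sqr_ge0 J) Hmu.
rewrite mulrDr exprMn; lra.
Qed.

Lemma error_step_arith (nu mu CH K G J E eta a D lam bb ii : R) : 0 <= mu -> 0 <= lam ->
  lam * CH ^+ 2 <= nu -> lam * 2 <= mu -> 0 <= K -> 0 <= CH ->
  (K * CH) ^+ 2 <= nu / 2 -> 4 * K ^+ 2 <= mu ->
  0 <= a -> 0 <= E ->
  nu * G ^+ 2 + bb + mu * (J ^+ 2 - ii) = 0 ->
  E <= J + D -> D <= CH * G -> `|ii| <= eta * J -> `|bb| <= K * (a * E) ->
  lam * E ^+ 2 <= 2 * a ^+ 2 + 2 * mu * eta ^+ 2.
Proof.
move=> mu0 lam0 Hnu Hmu K0 CH0 HB HK a0 E0 Heq tri HD Hii Hbb.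
have tri2 : E <= J + CH * G by lra.
apply: (le_trans (lambda_bar_energy lam0 CH0 Hnu Hmu E0 tri2)).
apply: (energy_absorption mu0 HB HK).
have := ler_wpM2l mu0 (le_trans (ler_norm _) Hii).
have : - bb <= K * (a * E) by apply: le_trans Hbb; rewrite ler_normr lexx orbT.
have := ler_wpM2l K0 (ler_wpM2l a0 tri2).
move: Heq; lra.
Qed.

(** The constant c / (l - 2) is the fixed point of x |-> (2 x + c) / l. *)
Lemma geometric_recursion (A : nat -> R) (l c : R) : 2 < l -> 0 <= c ->
  (forall k, l * A k.+1 <= 2 * A k + c) ->
  forall k, A k <= (2 / l) ^+ k * A 0%N + c / (l - 2).
Proof.
move=> l2 c0 H; have l0 : 0 < l by lra.
have l20 : 0 < l - 2 by lra.
elim=> [|k IH]; first by rewrite expr0 mul1r lerDl divr_ge0// ltW.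
rewrite -(ler_pM2l l0); apply: (le_trans (H k)).
have -> : l * ((2 / l) ^+ k.+1 * A 0%N + c / (l - 2)) =
    2 * ((2 / l) ^+ k * A 0%N + c / (l - 2)) + c.
  by rewrite exprS; field; rewrite !gt_eqF.
by rewrite lerD2r ler_pM2l.
Qed.

End error_estimate.

Section CDA_step.
Context (R : realType) (d : nat) (Omega : set 'rV[R]_d).
Hypothesis oO : open Omega.
Hypothesis hd : d = 2%N \/ d = 3%N.
Let mO : measurable Omega := open_measurable_rV oO.
Context (nu mu H CI K1 : R).
Context (I : ('rV[R]_d -> 'rV[R]_d) -> 'rV[R]_d -> 'rV[R]_d).
Context (f : field_grad R d -> R).
Context (u eps : field_grad R d) (u_ : nat -> field_grad R d).
Hypothesis mu_gt0 : 0 < mu.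
Hypothesis hI : coarse_interpolant Omega CI H I.
Hypothesis hu : steady_NS Omega nu f u.
Hypothesis hK1 : norm_infty Omega (grad u) = K1%:E.
Hypothesis heps : V Omega eps.
Hypothesis hu_ : CDA_Picard Omega nu mu f I u eps u_.

(** Difference of the equations of u_{k+1} and u tested with e_{k+1}. The
interpolation operator is linear only almost everywhere, hence the detour by
[eq_ip_ae]; the term b(u_k, e_{k+1}, e_{k+1}) disappears by [b_skew]. *)
Lemma error_equation k :
  nu * ip Omega (grad (u_ k.+1 - u)) (grad (u_ k.+1 - u))
  + b Omega (u_ k - u) u (u_ k.+1 - u)
  + mu * (ip Omega (I (fval (u_ k.+1 - u))) (I (fval (u_ k.+1 - u)))
          - ip Omega (I (fval eps)) (I (fval (u_ k.+1 - u)))) = 0.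
Proof.
have [Vk Hk] := hu_; have [Vu Hu] := hu.
have VE := V_sub oO (Vk k.+1) Vu.
have Xu := V_X Vu; have Xk := V_X (Vk k); have Xk1 := V_X (Vk k.+1).
have XE := V_X VE; have Xe := V_X heps.
have [IL2 Ilin _ _] := hI.
have [[_ Lgu _] _] := Xu; have [[_ Lgk1 _] _] := Xk1; have [[_ LgE _] _] := XE.
have := Hk k _ VE; rewrite -(Hu _ VE) => Heq.
have Iip : ip Omega (I (fval (u_ k.+1)) - I (fval (u + eps))) (I (fval (u_ k.+1 - u))) =
    ip Omega (I (fval (u_ k.+1 - u)) - I (fval eps)) (I (fval (u_ k.+1 - u))).
  have LE := IL2 _ XE; have Le := IL2 _ Xe.
  apply: (eq_ip_ae mO (L2B mO (IL2 _ Xk1) (IL2 _ (X_add oO Xu Xe))) (L2B mO LE Le) LE).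
  have := Ilin 1 _ _ XE Xu; have := Ilin 1 _ _ Xe Xu.
  rewrite !scale1r.
  have -> : fval (u_ k.+1 - u) + fval u = fval (u_ k.+1) by exact: subrK.
  have -> : fval eps + fval u = fval (u + eps) by exact: addrC.
  apply: filterS2 => x H1 H2 Ox.
  have := H1 Ox; have := H2 Ox; rewrite !scale1r => E1 E2.
  rewrite -[LHS]/(I (fval (u_ k.+1)) x - I (fval (u + eps)) x) E1 E2.
  by rewrite -[RHS]/(I (fval (u_ k.+1 - u)) x - I (fval eps) x) opprD addrACA subrr addr0.
have LE := IL2 _ XE; have Le := IL2 _ Xe.
have bsplit : b Omega (u_ k) (u_ k.+1) (u_ k.+1 - u) - b Omega u u (u_ k.+1 - u) =
    b Omega (u_ k - u) u (u_ k.+1 - u).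
  have := bBm oO hd Xk Xk1 Xu XE; rewrite (b_skew oO hd (Vk k) XE) => H0.
  by rewrite (bBl oO hd Xk Xu Xu XE); lra.
have gsplit : ip Omega (grad (u_ k.+1 - u)) (grad (u_ k.+1 - u)) =
    ip Omega (grad (u_ k.+1)) (grad (u_ k.+1 - u)) - ip Omega (grad u) (grad (u_ k.+1 - u)).
  exact: (ipBl mO Lgk1 Lgu LgE).
rewrite -(ipBl mO LE Le LE) -Iip gsplit -bsplit.
move: Heq; lra.
Qed.

Lemma error_step k : 0 < CI -> 0 < H -> 0 <= nu -> 
  (K1 * (CI * H)) ^+ 2 <= nu / 2 -> 4 * K1 ^+ 2 <= mu ->
  lambda_bar nu CI H mu * norm2 Omega (fval (u_ k.+1 - u)) ^+ 2 <=
  2 * norm2 Omega (fval (u_ k - u)) ^+ 2 + 2 * mu * norm2 Omega (I (fval eps)) ^+ 2.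
Proof.
move=> CI0 H0 nu0 HB HK.
have CH0 : 0 <= CI * H by rewrite mulr_ge0// ltW.
set lam := lambda_bar _ _ _ _.
have lam0 : 0 <= lam.
  by rewrite /lam /lambda_bar le_min; apply/andP; split; apply: divr_ge0 => //;
    rewrite ?mulr_ge0 ?sqr_ge0// ltW.
have Hnu : lam * (CI * H) ^+ 2 <= nu.
  have c0 : 0 < CI ^+ 2 * H ^+ 2 by rewrite mulr_gt0// exprn_gt0.
  by rewrite exprMn -ler_pdivlMr// ge_min lexx.
have Hmu : lam * 2 <= mu by rewrite -ler_pdivlMr// ge_min lexx orbT.
have Heq := error_equation k.
have [Vk _] := hu_; have [Vu _] := hu.
have XE := V_X (V_sub oO (Vk k.+1) Vu); have Xek := V_X (V_sub oO (Vk k) Vu).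
have Xu := V_X Vu; have Xe := V_X heps.
have [IL2 _ Iapp _] := hI.
have LE := IL2 _ XE; have Le := IL2 _ Xe.
have [K0 _] := norm_infty_ae hK1.
have := norm_b_le oO hd Xek Xu XE hK1.
have := ip_le_norm2 mO Le LE; have := Iapp _ XE.
have [[LEv _ _] _] := XE.
have tri : norm2 Omega (fval (u_ k.+1 - u)) <= norm2 Omega (I (fval (u_ k.+1 - u))) +
    norm2 Omega (I (fval (u_ k.+1 - u)) - fval (u_ k.+1 - u)).
  rewrite -[X in _ <= _ + X]norm2N.
  apply: le_trans (norm2D mO LE (L2N mO (L2B mO LE LEv))).
  by rewrite opprB addrCA subrr addr0.
move: Heq tri; rewrite -!norm2_sqr.
move: (b Omega _ _ _) (ip Omega _ _) => bb ii.
move: (norm2_ge0 Omega (grad (u_ k.+1 - u))) (norm2_ge0 Omega (I (fval (u_ k.+1 - u))))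
  (norm2_ge0 Omega (fval (u_ k - u))) (norm2_ge0 Omega (fval (u_ k.+1 - u))).
move: (norm2 Omega (grad (u_ k.+1 - u))) (norm2 Omega (I (fval (u_ k.+1 - u))))
  (norm2 Omega (fval (u_ k - u))) (norm2 Omega (fval (u_ k.+1 - u)))
  (norm2 Omega (I (fval eps))) (norm2 Omega (I (fval (u_ k.+1 - u)) - fval (u_ k.+1 - u))).
move=> G J a E eta D G0 J0 a0 E0 Heq tri HD Hii Hbb.
exact: (error_step_arith (ltW mu_gt0) lam0 Hnu Hmu K0 CH0 HB HK a0 E0 Heq tri HD Hii Hbb).
Qed.

End CDA_step.

(** * The error estimate *)

(** The condition on H, squared; when K1 = 0 there is nothing to require. *)
Lemma mesh_condition (R : rcfType) (nu CI H K1 : R) : 0 <= nu -> 0 < CI -> 0 < H ->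
  0 <= K1 -> (0 < K1 -> H <= Num.sqrt nu / (Num.sqrt 2 * K1 * CI)) ->
  (K1 * (CI * H)) ^+ 2 <= nu / 2.
Proof.
move=> nu0 CI0 H0; rewrite le_eqVlt => /predU1P[<- _|K0 /(_ K0)].
  by rewrite mul0r expr0n divr_ge0.
have s20 : 0 < Num.sqrt 2 :> R by rewrite sqrtr_gt0.
rewrite ler_pdivlMr ?mulr_gt0// => Hle.
have : (H * (Num.sqrt 2 * K1 * CI)) ^+ 2 <= Num.sqrt nu ^+ 2.
  by rewrite ler_pXn2r// nnegrE ?sqrtr_ge0// ltW// !mulr_gt0.
rewrite (sqr_sqrtr nu0).
have -> : (H * (Num.sqrt 2 * K1 * CI)) ^+ 2 = Num.sqrt 2 ^+ 2 * (K1 * (CI * H)) ^+ 2.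
  by ring.
by rewrite sqr_sqrtr// => ?; lra.
Qed.

Lemma mesh_width_equiv (R : rcfType) (nu mu CI H : R) :
  0 < nu -> 0 < mu -> 0 < CI -> 0 < H ->
  (mu <= nu / (CI ^+ 2 * H ^+ 2)) = (H <= Num.sqrt nu / (Num.sqrt mu * CI)).
Proof.
move=> nu0 mu0 CI0 H0.
have sm0 : 0 < Num.sqrt mu by rewrite sqrtr_gt0.
rewrite !ler_pdivlMr ?mulr_gt0 ?exprn_gt0//.
rewrite -[RHS](@ler_pXn2r _ 2)// ?nnegrE ?sqrtr_ge0//; last first.
  by rewrite ltW// !mulr_gt0.
rewrite !exprMn (sqr_sqrtr (ltW mu0)) (sqr_sqrtr (ltW nu0)).
by have -> : mu * (CI ^+ 2 * H ^+ 2) = H ^+ 2 * (mu * CI ^+ 2) by ring.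
Qed.

Theorem theorem4p7 (R : realType) (d : nat) (Omega : set 'rV[R]_d)
    (nu mu H CI K1 delta : R) (widths : set R)
    (I_ : R -> ('rV[R]_d -> 'rV[R]_d) -> 'rV[R]_d -> 'rV[R]_d)
    (f : field_grad R d -> R)
    (N : nat) (xs noise : 'I_N -> 'rV[R]_d)
    (u eps : field_grad R d) (u_ : nat -> field_grad R d)
    (hd : d = 2%N \/ d = 3%N)
    (Omega_open : open Omega) (Omega_connected : connected Omega)
    (Omega_reg : convex_polygon Omega \/ smooth_boundary Omega)
    (nu_gt0 : 0 < nu) (mu_gt0 : 0 < mu) (CI_gt0 : 0 < CI)
    (* C_I does not depend on the mesh width *)
    (hI : forall h, widths h -> 0 < h /\ coarse_interpolant Omega CI h (I_ h))
    (hH : widths H)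
    (hf : Hm1 Omega f)
    (hu : steady_NS Omega nu f u)
    (hK1 : norm_infty Omega (grad u) = K1%:E)
    (heps : V Omega eps)
    (hnoise : forall i, closure Omega (xs i) /\
                        I_ H (fval eps) (xs i) = noise i)
    (delta_ge0 : 0 <= delta)
    (hdelta : norm2 Omega (grad (u + eps)) <=
              (1 + delta) * norm2 Omega (grad u))
    (hu_ : CDA_Picard Omega nu mu f (I_ H) u eps u_)
    (hlambda : 2 < lambda_bar nu CI H mu)
    (* when K1 = 0 the upper bound on H is +oo *)
    (hH_le : 0 < K1 -> H <= Num.sqrt nu / (Num.sqrt 2 * K1 * CI))
    (hmu_ge : 4 * K1 ^+ 2 <= mu) :
  let e k := u_ k - u in
  let lbar := lambda_bar nu CI H mu in
  [/\ forall k : nat,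
        norm2 Omega (fval (e k)) ^+ 2 <=
          (2 / lbar) ^+ k * norm2 Omega (fval (e 0%N)) ^+ 2
          + 2 * mu / (lbar - 2) * norm2 Omega (I_ H (fval eps)) ^+ 2,
      mu <= nu / (CI ^+ 2 * H ^+ 2) <->
        H <= Num.sqrt nu / (Num.sqrt mu * CI)
    & mu <= nu / (CI ^+ 2 * H ^+ 2) ->
      forall k : nat,
        norm2 Omega (fval (e k)) ^+ 2 <=
          (2 / lbar) ^+ k * norm2 Omega (fval (e 0%N)) ^+ 2
          + 4 * mu / (mu - 4) * norm2 Omega (I_ H (fval eps)) ^+ 2].
Proof.
move=> e lbar; have [H0 hIH] := hI _ hH; have [K0 _] := norm_infty_ae hK1.
have HB := mesh_condition (ltW nu_gt0) CI_gt0 H0 K0 hH_le.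
have rec k := error_step Omega_open hd mu_gt0 hIH hu hK1 heps hu_ k CI_gt0 H0
  (ltW nu_gt0) HB hmu_ge.
have eta0 : 0 <= 2 * mu * norm2 Omega (I_ H (fval eps)) ^+ 2.
  by rewrite mulr_ge0 ?sqr_ge0// mulr_ge0// ltW.
have bound := geometric_recursion hlambda eta0 rec.
split.
(* the recursion yields (2 mu eta^2) / (lbar - 2) *)
- by move=> k; rewrite mulrAC; exact: bound.
- by rewrite mesh_width_equiv.
move=> mu_le k; have lbarE : lbar = mu / 2.
  rewrite /lbar /lambda_bar min_r//; apply: le_trans mu_le.
  by rewrite ler_pdivrMr// ler_peMr ?ltW// ltr1n.
have mu4 : 4 < mu by move: hlambda; rewrite -/lbar lbarE; lra.
have -> : 4 * mu / (mu - 4) = 2 * mu / (lbar - 2).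
  by rewrite lbarE; field; rewrite subr_eq0 gt_eqF.
by rewrite mulrAC; exact: bound.
Qed.
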